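(* Let $l$ be an odd prime, let $K$ be a non-Galois number field of degree $l$ whose Galois closure $L$ over $\mathbb{Q}$ has Galois group $\operatorname{Gal}(L/\mathbb{Q})\simeq D_l$, the dihedral group of order $2l$, and let $E$ be the unique quadratic subfield of $L$. Then there is an exact sequence $$\{0\}\longrightarrow \operatorname{Po}(E)\longrightarrow \operatorname{Po}(L)\longrightarrow \operatorname{Po}(K).$$ Moreover, the $2$-torsion subgroup of $\operatorname{Po}(L)$ is isomorphic to $\operatorname{Po}(E)$, and the $l$-torsion subgroup of $\operatorname{Po}(L)$ embeds in $\operatorname{Po}(K)$. In particular, if $l\nmid h(K)$, then $\operatorname{Po}(E)\simeq \operatorname{Po}(L)$.
   Context: For a number field $M$ with ring of integers $\mathcal{O}_M$, $\operatorname{Cl}(M)$ is its ideal class group and $h(M)=\#\operatorname{Cl}(M)$. For an integer $q\ge 2$ let $\Pi_q(M)$ be the product of all maximal ideals $\mathfrak{m}$ of $\mathcal{O}_M$ of absolute norm $N_{M/\mathbb{Q}}(\mathfrak{m})=q$ (an empty product is $\mathcal{O}_M$). The Pólya group $\operatorname{Po}(M)$ is the subgroup of $\operatorname{Cl}(M)$ generated by the classes of all the ideals $\Pi_q(M)$. *)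

(* Defs.v *)
From HB Require Import structures.
From mathcomp Require Import all_boot all_order all_fingroup all_algebra.
From mathcomp Require Import all_solvable all_field finmap.
From mathcomp Require Import boolp classical_sets cardinality.

Set Implicit Arguments.
Unset Strict Implicit.
Unset Printing Implicit Defensive.

Import GRing.Theory.
Local Open Scope ring_scope.
Local Open Scope quotient_scope.
Local Open Scope classical_set_scope.

(* A number field is a subfield M of a finite extension L of rat; its ideals
   and fractional ideals are subsets of L contained in M.  A number field M
   given on its own is the case of {:M}. *)
Section Ideals.
Variables (L : fieldExtType rat) (M : {subfield L}).
Implicit Types (I J H : set L) (x y : L).

Definition ringInt : set L :=
  [set x | x \in M /\ integralOver (intr : int -> L) x].

Definition submod I : Prop :=
  [/\ I 0, forall x y, I x -> I y -> I (x + y)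
    & forall a x, ringInt a -> I x -> I (a * x)].

Definition ideal I : Prop := I `<=` ringInt /\ submod I.

Definition maxIdeal I : Prop :=
  [/\ ideal I, I <> ringInt
    & forall J, ideal J -> I `<=` J -> J = I \/ J = ringInt].

(* N(I) = #(O_M / I), and 0 when the quotient is infinite *)
Definition absNorm I : nat :=
  #|` fset_set [set [set x + y | y in I] | x in ringInt] |.

Definition idmul I J : set L :=
  [set x | exists2 s : seq (L * L),
     forall p, p \in s -> I p.1 /\ J p.2 & x = \sum_(p <- s) p.1 * p.2].

Definition PolyaIdeal (q : nat) : set L :=
  \big[idmul/ringInt]_(m <- fset_set [set m | maxIdeal m /\ absNorm m = q]) m.

Definition fracIdeal I : Prop :=
  [/\ I `<=` [set x | x \in M], submod I
    & exists d, [/\ ringInt d, d != 0 & forall x, I x -> ringInt (d * x)]].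

Definition invertible I : Prop :=
  fracIdeal I /\ exists2 J, fracIdeal J & idmul I J = ringInt.

Definition colon I : set L :=
  [set x | x \in M /\ forall y, I y -> ringInt (x * y)].

Lemma ringInt0 : ringInt 0.
Proof. by split; [exact: mem0v | exact: integral0]. Qed.

Lemma ringInt1 : ringInt 1.
Proof. by split; [exact: mem1v | exact: integral1]. Qed.

Lemma ringIntD x y : ringInt x -> ringInt y -> ringInt (x + y).
Proof. by move=> [? ?] [? ?]; split; [exact: rpredD | exact: integral_add]. Qed.

Lemma ringIntM x y : ringInt x -> ringInt y -> ringInt (x * y).
Proof. by move=> [? ?] [? ?]; split; [exact: rpredM | exact: integral_mul]. Qed.

Lemma idmul_min I J H : H 0 -> (forall x y, H x -> H y -> H (x + y)) ->
  (forall x y, I x -> J y -> H (x * y)) -> idmul I J `<=` H.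
Proof.
move=> H0 HD HM x [s sIJ ->]; rewrite big_seq.
by apply: big_ind => // p /sIJ[]; exact: HM.
Qed.

Lemma idmul_mem I J x y : I x -> J y -> idmul I J (x * y).
Proof.
by move=> Ix Jy; exists [:: (x, y)]; [move=> p /[!inE] /eqP-> | rewrite big_seq1].
Qed.

Lemma idmul0 I J : idmul I J 0.
Proof. by exists [::]; rewrite ?big_nil. Qed.

Lemma idmulD I J x y : idmul I J x -> idmul I J y -> idmul I J (x + y).
Proof.
move=> [s sP ->] [t tP ->]; exists (s ++ t); last by rewrite big_cat.
by move=> p; rewrite mem_cat => /orP[/sP|/tP].
Qed.

Lemma idmulZ I J a x : submod I -> ringInt a -> idmul I J x -> idmul I J (a * x).
Proof.
move=> [_ _ IZ] aO; move: x.
apply: (@idmul_min I J (fun x => idmul I J (a * x))).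
- by rewrite mulr0; exact: idmul0.
- by move=> x y ? ?; rewrite mulrDr; exact: idmulD.
- by move=> x y Ix Jy; rewrite mulrA; apply: idmul_mem => //; exact: IZ.
Qed.

Lemma idmulC : commutative idmul.
Proof.
move=> I J; apply/seteqP; split.
all: apply: idmul_min; [exact: idmul0 | exact: idmulD | ].
all: by move=> x y ? ?; rewrite mulrC; exact: idmul_mem.
Qed.

Lemma idmulA : associative idmul.
Proof.
move=> I J H; apply/seteqP; split.
- apply: idmul_min; [exact: idmul0 | exact: idmulD | move=> x y Ix; move: y].
  apply: (@idmul_min J H (fun y => idmul (idmul I J) H (x * y))).
  + by rewrite mulr0; exact: idmul0.
  + by move=> y z ? ?; rewrite mulrDr; exact: idmulD.
  + by move=> y z ? ?; rewrite mulrA; apply: idmul_mem => //; exact: idmul_mem.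
- apply: idmul_min; [exact: idmul0 | exact: idmulD | move=> x z + Hz; move: x].
  apply: (@idmul_min I J (fun x => idmul I (idmul J H) (x * z))).
  + by rewrite mul0r; exact: idmul0.
  + by move=> x y ? ?; rewrite mulrDl; exact: idmulD.
  + by move=> x y ? ?; rewrite -mulrA; apply: idmul_mem => //; exact: idmul_mem.
Qed.

Lemma idmul1 I : submod I -> idmul ringInt I = I.
Proof.
move=> [I0 ID IZ]; apply/seteqP; split; first exact: idmul_min.
by move=> x Ix; rewrite -[x]mul1r; apply: idmul_mem => //; exact: ringInt1.
Qed.

Lemma fracIdeal1 : fracIdeal ringInt.
Proof.
split; first by move=> x [].
- split; [exact: ringInt0 | exact: ringIntD | exact: ringIntM].
- exists 1; split; [exact: ringInt1 | exact: oner_neq0 | ].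
  by move=> x; rewrite mul1r.
Qed.

Lemma fracIdealM I J : fracIdeal I -> fracIdeal J -> fracIdeal (idmul I J).
Proof.
move=> [IM Isub [d [dO d0 dI]]] [JM Jsub [e [eO e0 eJ]]]; split.
- apply: idmul_min => [|x y|x y /IM xM /JM yM] /=; first exact: mem0v.
  + exact: rpredD.
  + exact: rpredM.
- by split; [exact: idmul0 | exact: idmulD | move=> a x; exact: idmulZ].
- exists (d * e); split; [exact: ringIntM | by rewrite mulf_neq0 | ].
  apply: (@idmul_min I J (fun x => ringInt (d * e * x))).
  + by rewrite mulr0; exact: ringInt0.
  + by move=> x y ? ?; rewrite mulrDr; exact: ringIntD.
  + by move=> x y ? ?; rewrite mulrACA; apply: ringIntM; [exact: dI | exact: eJ].
Qed.

Lemma invertible1 : invertible ringInt.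
Proof.
split; first exact: fracIdeal1.
by exists ringInt; rewrite ?idmul1 //; case: fracIdeal1.
Qed.

Lemma invertibleM I J : invertible I -> invertible J -> invertible (idmul I J).
Proof.
move=> [fI [I' fI' II']] [fJ [J' fJ' JJ']]; split; first exact: fracIdealM.
exists (idmul I' J'); first exact: fracIdealM.
rewrite (idmulC I') idmulA -(idmulA I) JJ' -idmulA idmul1 //; last by case: fI'.
Qed.

Lemma colonP I J : fracIdeal J -> submod I -> idmul I J = ringInt -> colon I = J.
Proof.
move=> [JM Jsub _] Isub IJ; apply/seteqP; split=> x.
  move=> [xM xI]; rewrite -[x]mulr1.
  have := ringInt1; rewrite -{1}IJ.
  have [J0 JD JZ] := Jsub.
  apply: (@idmul_min I J (fun y => J (x * y))) => [|y z|y z Iy Jz].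
  - by rewrite mulr0.
  - by rewrite mulrDr; exact: JD.
  - by rewrite mulrA; apply: JZ => //; exact: xI.
move=> Jx; split; first exact: JM.
by move=> y Iy; rewrite -IJ mulrC; exact: idmul_mem.
Qed.

Lemma invertibleV I : invertible I ->
  invertible (colon I) /\ idmul (colon I) I = ringInt.
Proof.
move=> [fI [J fJ IJ]]; have Isub : submod I by case: fI.
rewrite (colonP fJ Isub IJ) idmulC; split=> //; split=> //.
by exists I; rewrite // idmulC.
Qed.

(* Nonzero fractional ideals of a ring of integers are all invertible
   (Dedekind), so this is the usual group of fractional ideals. *)
Definition fideal := {I : set L | `[< invertible I >]}.
HB.instance Definition _ := Choice.on fideal.

Definition fideal1 : fideal := exist _ ringInt (asboolT invertible1).

Definition fidealM (I J : fideal) : fideal :=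
  exist _ (idmul (val I) (val J))
    (asboolT (invertibleM (asboolW (valP I)) (asboolW (valP J)))).

Definition fidealV (I : fideal) : fideal :=
  exist _ (colon (val I)) (asboolT (invertibleV (asboolW (valP I))).1).

Lemma fideal_submod (I : fideal) : submod (val I).
Proof. by have /asboolP[[]] := valP I. Qed.

Fact fidealA : associative fidealM.
Proof. by move=> I J H; apply: val_inj; exact: idmulA. Qed.

Fact fidealC : commutative fidealM.
Proof. by move=> I J; apply: val_inj; exact: idmulC. Qed.

Fact fideal1M : left_id fideal1 fidealM.
Proof. by move=> I; apply: val_inj; apply: idmul1; exact: fideal_submod. Qed.

Fact fidealVM : left_inverse fideal1 fidealV fidealM.
Proof.
by move=> I; apply: val_inj; exact: (invertibleV (asboolW (valP I))).2.
Qed.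

(* Groups of ideals and of ideal classes are written additively: I + J is the
   product ideal, 0 the unit ideal and - I the inverse of I. *)
HB.instance Definition _ :=
  GRing.isZmodule.Build fideal fidealA fidealC fideal1M fidealVM.

Definition principal : {pred fideal} := fun I : fideal =>
  `[< exists a, [/\ a \in M, a != 0 & val I = [set a * x | x in ringInt]] >].

Fact principal_zmod_closed : zmod_closed principal.
Proof.
split.
  apply/asboolP; exists 1; split; [exact: mem1v | exact: oner_neq0 | ].
  apply/seteqP; split=> x /=; first by exists x; rewrite ?mul1r.
  by move=> [y yO <-]; rewrite mul1r.
move=> I J /asboolP[a [aM a0 Ia]] /asboolP[b [bM b0 Jb]].
apply/asboolP; exists (a / b); split; [exact: rpred_div | | ].
  by rewrite mulf_neq0 ?invr_neq0.
have HIJ : val (I - J) = idmul (val I) (colon (val J)) by [].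
rewrite HIJ; apply/seteqP; split.
  apply: idmul_min.
  - by exists 0; rewrite ?mulr0 //; exact: ringInt0.
  - move=> _ _ [x xO <-] [y yO <-]; exists (x + y); last by rewrite mulrDr.
    exact: ringIntD.
  - move=> x y; rewrite Ia => -[z zO <-] [_ yJ].
    exists (z * (y * b)); last first.
      by rewrite mulrACA [y * b]mulrC !mulrA mulfVK // mulrAC.
    apply: ringIntM => //; apply: yJ; rewrite Jb; exists 1; last exact: mulr1.
    exact: ringInt1.
move=> _ [x xO <-]; rewrite mulrAC; apply: idmul_mem.
  by rewrite Ia; exists x.
split; first by rewrite rpredV.
by move=> y; rewrite Jb => -[z zO <-]; rewrite mulKf.
Qed.

HB.instance Definition _ :=
  GRing.isZmodClosed.Build fideal principal principal_zmod_closed.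

Definition Cl := Quotient.quot principal.
HB.instance Definition _ := GRing.Zmodule.on Cl.

(* 0 when Cl is infinite, which never happens *)
Definition classNumber : nat := #|` fset_set [set: Cl] |.

Definition PolyaGen : set Cl :=
  [set c | exists2 q, (2 <= q)%N &
     exists2 I : fideal, val I = PolyaIdeal q & c = \pi_Cl I].

Definition PoPred : {pred Cl} :=
  mem (smallest (fun H : set Cl => zmod_closed (mem H)) PolyaGen).

Fact PoPred_zmod_closed : zmod_closed PoPred.
Proof.
split; first by apply/mem_set => H [[/set_mem]].
move=> x y /set_mem Px /set_mem Py; apply/mem_set => H HG.
by apply/set_mem; apply: HG.1.2; apply/mem_set; [exact: Px | exact: Py].
Qed.

HB.instance Definition _ :=
  GRing.isZmodClosed.Build Cl PoPred PoPred_zmod_closed.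

Definition Po := {c : Cl | c \in PoPred}.
HB.instance Definition _ := SubChoice.on Po.
HB.instance Definition _ := [SubChoice_isSubZmodule of Po by <:].

End Ideals.

Section Torsion.
Variables (n : nat) (G : zmodType).

Definition torsionPred : {pred G} := fun x => x *+ n == 0.

Fact torsionPred_zmod_closed : zmod_closed torsionPred.
Proof.
split; first by rewrite unfold_in mul0rn.
by move=> x y; rewrite !unfold_in mulrnBl => /eqP-> /eqP->; rewrite subr0.
Qed.

HB.instance Definition _ :=
  GRing.isZmodClosed.Build G torsionPred torsionPred_zmod_closed.

Definition torsion := {x : G | x \in torsionPred}.
HB.instance Definition _ := SubChoice.on torsion.
HB.instance Definition _ := [SubChoice_isSubZmodule of torsion by <:].

End Torsion.

Definition isomorphic (G H : zmodType) : Prop :=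
  exists f : {additive G -> H}, bijective f.

Definition embeds (G H : zmodType) : Prop :=
  exists f : {additive G -> H}, injective f.

(* N is the smallest subfield of L that contains K and is Galois over rat. *)
Definition galoisClosure (L : splittingFieldType rat) (K N : {subfield L}) :=
  [/\ (K <= N)%VS, galois 1 N
    & forall F : {subfield L}, (K <= F)%VS -> galois 1 F -> (N <= F)%VS].

(* Main.v *)
From HB Require Import structures.
Require Import Defs.
From mathcomp Require Import all_boot all_fingroup all_algebra.
From mathcomp Require Import all_solvable all_field finmap.
From mathcomp Require Import boolp classical_sets cardinality zify ring.

(* For a prime p let Pi_p(M) be the product of the maximal ideals of O_M above
   p.  When M is Galois over Q, conjugacy of these ideals shows that Po(M) is
   generated by the classes of the Pi_p(M), and that every Galois-invariant
   ideal containing a power of p is a power of Pi_p(M).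

   If M/F is Galois of degree n and J is a Gal(M/F)-invariant ideal of M, then
   J^n is the extension of the ideal of F generated by the norms of the elements
   of J.  With J = Pi_p(L) and F = Q, E, K this gives Pi_p(L)^(2l) = p^k,
   Pi_p(L)^l = b O_L and Pi_p(L)^2 = a O_L.  The ideal b is invariant, hence a
   power of Pi_p(E).  From a^l = p^k either l | k and a is principal, or p = q^l
   for some ideal q of which a is a power; then q is the only maximal ideal of
   O_K of norm p.  So multiplication by l maps Po(L) to the image of Po(E), and
   multiplication by 2 maps it to the image of the l-torsion of Po(K).

   Element norms show that the kernel of Cl(E) -> Cl(L) is killed by l and that
   of Cl(K) -> Cl(L) by 2, so that extension is injective on Po(E), which is
   killed by 2, and on the l-torsion of Cl(K).  The map Po(L) -> Po(K) sends x
   to the l-torsion class extending to 2 x. *)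

Set Implicit Arguments.
Unset Strict Implicit.
Unset Printing Implicit Defensive.

Import GRing.Theory.
Local Open Scope ring_scope.
Local Open Scope quotient_scope.
Local Open Scope classical_set_scope.

(** * Integral elements and rational integers *)

Section Integers.
Variable L : fieldExtType rat.
Implicit Types (M : {subfield L}) (x y : L).

(** Unique factorisation and ramification indices are replaced by two facts: nonzero ideals are
    invertible, and the group of ideals is torsion free, because [x] is integral as soon as [x ^+ n]
    is. An ideal is thus determined by any of its powers, and an equation such as a^l = p^k
    transfers invariance and integrality from p to a. The obstacle is K. No Galois group acts on it,
    and Po(K) is generated by products of maximal ideals of equal norm, so that Pi_p(K) need not be
    among the generators. Hence the ideal q with q^l = p has to be recognised as a Pi_q(K) through
    its norm, which is computed by showing that every class modulo q contains an integer. The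
    factors 2 and l are the degrees of L over K and over E. Being coprime, they let x be recovered
    from 2 x and l x. On Po(L) the second map is induced by the norm of ideals to K, since an
    invariant J satisfies J^2 = N(J) O_L. Its kernel is the 2-torsion; there multiplication by l is
    the identity, so that the kernel comes from Po(E). *)

Lemma intrL_eq0 (z : int) : (z%:~R == 0 :> L) = (z == 0).
Proof.
rewrite -(intr_eq0 rat) -(fmorph_eq0 (in_alg L)) /=; congr (_ == _).
exact/esym/(rmorph_int (in_alg L)).
Qed.

Lemma intrL_inj : injective (intr : int -> L).
Proof.
move=> y z /eqP; rewrite -subr_eq0 -rmorphB /= intrL_eq0 subr_eq0.
by move/eqP.
Qed.

Lemma natrL_eq0 (n : nat) : (n%:R == 0 :> L) = (n == 0).
Proof. by rewrite pmulrn intrL_eq0. Qed.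

(** Gauss's lemma: ['X - x] divides the monic integral polynomial [p] over [rat], hence is a scalar
    multiple of an integral factor [p1] of [p]. The leading coefficient of [p1] divides 1, so [x] is
    the constant coefficient of [p1] up to sign. *)
Lemma integral_rat_int (x : rat) :
  integralOver (intr : int -> L) x%:A -> exists z : int, x = z%:~R.
Proof.
move=> [p p_monic]; have -> : map_poly intr p = map_poly (in_alg L) (map_poly intr p).
  rewrite -map_poly_comp; apply: eq_map_poly => z /=.
  by rewrite -[RHS]/(in_alg L _) rmorph_int.
rewrite fmorph_root -dvdp_XsubCl => /dvdpP_rat_int[p1 [a a0 xE] [r pE]].
have : (lead_coef p1 %| 1)%Z.
  by apply/dvdzP; exists (lead_coef r); rewrite mulrC -lead_coefM -pE (eqP p_monic).
rewrite dvdz1 => /eqP p1_lead.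
have {}p1_lead : lead_coef p1 == 1 \/ lead_coef p1 == - 1 by lia.
have := lead_coefXsubC x; rewrite xE lead_coefZ lead_coef_map_inj //; last exact: intr_inj.
have := coefB 'X x%:P 0; rewrite xE coefZ coef_map coefX coefC /= sub0r.
move=> /eqP; rewrite eq_sym eqr_oppLR => /eqP ->.
case: p1_lead => /eqP ->; first by rewrite mulr1 => ->; exists (- p1`_0); rewrite mul1r rmorphN.
rewrite rmorphN1 mulrN1 => /eqP; rewrite eqr_oppLR => /eqP ->.
by exists p1`_0; rewrite mulN1r opprK.
Qed.

Lemma int_bezout (p : nat) (z : int) : prime p -> ~~ (p %| z)%Z ->
  exists u v : int, u%:~R * z%:~R + v%:~R * p%:R = 1 :> L.
Proof.
move=> p_pr pz; have /coprimezP[[u v] /= uv] : coprimez z p.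
  by rewrite coprimez_sym -[coprimez _ _]/(coprime p `|z|%N) prime_coprime.
by exists u, v; rewrite [p%:R]pmulrn -!rmorphM -rmorphD /= uv.
Qed.

Variable M : {subfield L}.

Lemma ringInt_int (z : int) : ringInt M z%:~R.
Proof. by split; [exact: rpred_int | exact: integral_id]. Qed.

Lemma ringInt_nat (n : nat) : ringInt M n%:R.
Proof. exact: (ringInt_int n). Qed.

Lemma ringIntN x : ringInt M x -> ringInt M (- x).
Proof. by rewrite -mulN1r; exact/ringIntM/(ringInt_int (- 1)). Qed.

Lemma ringIntB x y : ringInt M x -> ringInt M y -> ringInt M (x - y).
Proof. by move=> ? ?; apply: ringIntD => //; exact: ringIntN. Qed.

Lemma ringIntX n x : ringInt M x -> ringInt M (x ^+ n).
Proof.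
move=> Ox; elim: n => [|n IH]; first exact: ringInt1.
by rewrite exprS; exact: ringIntM.
Qed.

Lemma ringInt_sum (I : Type) (r : seq I) (P : pred I) (F : I -> L) :
  (forall i, P i -> ringInt M (F i)) -> ringInt M (\sum_(i <- r | P i) F i).
Proof. by move=> H; apply: big_ind => //; [exact: ringInt0 | exact: ringIntD]. Qed.

Lemma ringInt_prod (I : Type) (r : seq I) (P : pred I) (F : I -> L) :
  (forall i, P i -> ringInt M (F i)) -> ringInt M (\prod_(i <- r | P i) F i).
Proof. by move=> H; apply: big_ind => //; [exact: ringInt1 | exact: ringIntM]. Qed.

Lemma ringInt_rat x : x \in (1%AS : {subfield L}) -> ringInt M x ->
  exists z : int, x = z%:~R.
Proof.
move=> /vlineP[a ->] [_ /integral_rat_int[z ->]].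
by exists z; rewrite -[LHS]/(in_alg L _) rmorph_int.
Qed.

Lemma ringInt_Vnat (p : nat) : (1 < p)%N -> ~ ringInt M p%:R^-1.
Proof.
move=> p_gt1 /ringInt_rat[|z]; first by rewrite rpredV rpred_nat.
have p0 : p%:R != 0 :> L by rewrite natrL_eq0; case: p p_gt1.
move/(congr1 ( *%R p%:R)); rewrite mulfV // pmulrn -intrM -[1]/(1%:~R) => /intrL_inj.
move=> pz; have : (p%:Z %| 1)%Z by apply/dvdzP; exists z; rewrite mulrC.
by rewrite dvdz1 absz_nat; case: p p_gt1 {p0 pz} => [|[]].
Qed.

Lemma ringInt_dvdn (m n : nat) : (0 < m)%N -> ringInt M (n%:R / m%:R) -> (m %| n)%N.
Proof.
move=> m_gt0 /ringInt_rat[|z]; first by rewrite rpred_div ?rpred_nat.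
have m0 : m%:R != 0 :> L by rewrite natrL_eq0 -lt0n.
move/(canRL (divfK m0)); rewrite !pmulrn -intrM => /intrL_inj nE.
by have := dvdz_mull z (dvdzz m); rewrite -nE.
Qed.

Lemma integral_poly_int x (p : {poly int}) :
  ringInt M x -> ringInt M (map_poly intr p).[x].
Proof.
move=> [xM xO]; split.
  apply: rpred_horner => //; apply/polyOverP => i.
  by rewrite coef_map; exact: rpred_int.
apply: integral_horner => // _ /(nthP 0)[i _ <-].
by rewrite coef_map; exact: integral_id.
Qed.

(** A substitute for the norm of [x]: once the powers of ['X] are removed from a monic equation of
    [x], its constant coefficient is a nonzero integer, and the rest of the equation exhibits it as
    a multiple of [x]. *)
Lemma ringInt_norm x : ringInt M x -> x != 0 ->
  exists2 y, ringInt M y & exists2 n : nat, (0 < n)%N & x * y = n%:R.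
Proof.
move=> xO x0; have [_ [p p_monic]] := xO.
have p0 := monic_neq0 p_monic.
have [k [q]] := multiplicity_XsubC p 0; rewrite p0 /= => q00 ->.
rewrite rmorphM rmorphXn /= rmorphB /= map_polyX map_polyC /= rootM => /orP[]; last first.
  by rewrite subr0 /root hornerXn expf_eq0 (negPf x0) andbF.
have : root (q - (q.[0])%:P) 0 by rewrite /root !hornerE subrr.
move=> /factor_theorem[r /(canRL (subrK _)) ->].
rewrite subr0 rmorphD rmorphM /= map_polyX map_polyC /root !hornerE.
rewrite addr_eq0 => /eqP xrE.
pose y := (map_poly intr r).[x].
have yO : ringInt M y by exact: integral_poly_int.
have [n qn] : exists n : nat, q.[0] = n \/ q.[0] = - n%:Z by exists `|q.[0]|%N; lia.
have n_gt0 : (0 < n)%N.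
  by rewrite lt0n; apply: contraNneq q00 => n0; case: qn; rewrite n0 /root => ->.
case: qn => qn.
  exists (- y); [exact: ringIntN | exists n => //].
  by rewrite mulrN mulrC xrE opprK qn.
exists y => //; exists n => //; by rewrite mulrC xrE qn /= mulrNz opprK.
Qed.

End Integers.

(** * Finiteness of the ring of integers modulo [N] *)

Section Residues.
Variables (L : fieldExtType rat) (M : {subfield L}).

(** A rational relation exists for dimension reasons. Clearing denominators makes it integral, and
    dividing by [p] as long as possible makes it nontrivial modulo [p]. *)
Lemma int_dependent (p : nat) (s : seq L) : (1 < p)%N -> {subset s <= M} ->
  (\dim M < size s)%N -> exists a : nat -> int,
   \sum_(i < size s) (a i)%:~R * s`_i = 0 /\ exists2 i, (i < size s)%N & ~~ (p %| a i)%Z.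
Proof.
move=> p_gt1 sM dim_lt.
have : ~~ free (in_tuple s).
  rewrite /free neq_ltn (leq_ltn_trans _ dim_lt) //; apply: dimvS.
  by apply/span_subvP => x; exact: sM.
move/freeP => Nfree.
have [k [ksum [i0 ki0]]] : exists k : 'I_(size s) -> rat,
    \sum_i k i *: s`_i = 0 /\ exists i, k i != 0.
  apply: contra_notP Nfree => /forallNP H k ksum i.
  by apply/eqP; apply: contra_notT (H k) => ki; split=> //; exists i.
pose c i : int := numq (k i) * \prod_(j | j != i) denq (k j).
have {ksum} csum : \sum_i (c i)%:~R * s`_i = 0.
  transitivity ((\prod_j denq (k j))%:~R *: \sum_i k i *: s`_i); last first.
    by rewrite ksum scaler0.
  rewrite scaler_sumr; apply: eq_bigr => i _.
  rewrite scalerA -mulr_algl; congr (_ * _).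
  rewrite -(rmorph_int (in_alg L)) /=; congr (_ *: _).
  rewrite (bigD1 i) //= /c !rmorphM /= mulrAC; congr (_ * _).
  by rewrite mulrC numqE.
have ci0 : c i0 != 0.
  rewrite mulf_neq0 ?numq_eq0 //; apply/prodf_neq0 => j _; exact: denq_neq0.
(* Descent on the absolute value of one nonzero coefficient, which each division by [p]
   decreases. *)
have [n cn] := ubnP `|c i0|%N; clearbody c => {k ki0}.
elim: n c csum ci0 cn => // n IH c csum ci0 cn.
have [/forallP p_dvd | /forallPn[i Ni]] := boolP [forall i, (p %| c i)%Z]; last first.
  exists (fun i => if insub i is Some j then c j else 0); split; last first.
    by exists i => //; rewrite valK.
  by rewrite -[RHS]csum; apply: eq_bigr => j _; rewrite valK.
have cE i : c i = (c i %/ p)%Z * p by rewrite divzK.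
apply: (IH (fun i => (c i %/ p)%Z)).
- apply: (@mulIf _ (p%:R : L)); first by rewrite natrL_eq0; lia.
  rewrite mul0r mulr_suml -[RHS]csum; apply: eq_bigr => i _.
  by rewrite mulrAC [in RHS]cE intrM.
- by apply: contraNneq ci0 => c0; rewrite cE c0 mul0r.
- move: cn ci0; rewrite {1 2}(cE i0); set z := (_ %/ _)%Z; rewrite abszM /=; nia.
Qed.

(** The list meets every class modulo [N], possibly several times. It takes the place of an integral
    basis in all finiteness arguments. *)
Definition residues (N : nat) (s : seq L) : Prop :=
  (forall x, x \in s -> ringInt M x) /\
  forall x, ringInt M x ->
    exists2 y, y \in s & exists2 z, ringInt M z & x = y + N%:R * z.

Lemma residues_prime (p : nat) : prime p -> exists s, residues p s.
Proof.
move=> p_pr; have p_gt0 := prime_gt0 p_pr.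
have p0 : p%:R != 0 :> L by rewrite natrL_eq0; lia.
pose comb (b : seq L) (a : nat -> int) := \sum_(i < size b) (a i)%:~R * b`_i.
(* [b] is a family independent modulo [p]. By [int_dependent] it has at most [\dim M] members, so it
   can be enlarged only finitely often; [k] bounds the remaining room. A family that cannot be
   enlarged spans the ring modulo [p], and its combinations with coefficients below [p] are the
   residues. *)
suff H k (b : seq L) : (size b + k = (\dim M).+1)%N ->
    (forall x, x \in b -> ringInt M x) ->
    (forall a, (exists2 z, ringInt M z & comb b a = p%:R * z) ->
       forall i, (i < size b)%N -> (p %| a i)%Z) -> exists s, residues p s.
  exact: (H _ [::] (add0n _)).
elim: k b => [|k IH] b bk bO b_ind.
  have [|||a [a0 [i ib]]] := @int_dependent p b.
  - exact: prime_gt1.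
  - by move=> x /bO[].
  - by rewrite -[size b]addn0 bk.
  by rewrite b_ind //; exists 0; [exact: ringInt0 | rewrite mulr0].
have [b_span | ] := pselect (forall x, ringInt M x ->
    exists a, exists2 z, ringInt M z & x = comb b a + p%:R * z).
  exists [seq comb b (fun i => if insub i is Some j then Posz (f j) else 0)
         | f : {ffun 'I_(size b) -> 'I_p}]; split.
    move=> _ /codomP[f ->]; apply: ringInt_sum => i _; apply: ringIntM.
      exact: ringInt_int.
    by apply: bO; exact: mem_nth.
  move=> x /b_span[a [z Oz ->]].
  have red (i : nat) : (`|a i %% p|%Z < p)%N.
    have := @ltz_pmod (a i) p; have := modz_ge0 (a i) (d := p); lia.
  exists (comb b (fun i => (a i %% p)%Z)).
    apply/codomP; exists [ffun i : 'I_(size b) => Ordinal (red i)].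
    apply: eq_bigr => i _; rewrite valK ffunE /= gez0_abs //.
    by apply: modz_ge0; lia.
  exists (z + \sum_(i < size b) (a i %/ p)%Z%:~R * b`_i).
    apply: ringIntD => //; apply: ringInt_sum => i _; apply: ringIntM.
      exact: ringInt_int.
    by apply: bO; exact: mem_nth.
  rewrite mulrDr [p%:R * z + _]addrC addrA; congr (_ + _).
  rewrite mulr_sumr -big_split /=; apply: eq_bigr => i _.
  by rewrite {1}(divz_eq (a i) p) rmorphD rmorphM /=; ring.
move=> /existsNP[x /not_implyP[Ox xN]].
apply: (IH (x :: b)); rewrite /= ?addSn -?addnS //.
  by move=> y; rewrite inE => /predU1P[->|/bO].
move=> a [z Oz]; rewrite /comb /= big_ord_recl /=.
rewrite (eq_bigr (fun i : 'I_(size b) => (a i.+1)%:~R * b`_i)) //.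
rewrite -/(comb b (fun i => a i.+1)) => aE.
have [/dvdzP[c a0E] | Na0] := boolP (p %| a 0%N)%Z.
  case=> [|i] ib; first by rewrite a0E dvdz_mull.
  apply: (b_ind (fun i => a i.+1)) => //.
  exists (z - c%:~R * x).
    by apply: ringIntB => //; apply: ringIntM => //; exact: ringInt_int.
  rewrite mulrBr -aE a0E rmorphM /=; ring.
(* If the coefficient of [x] were prime to [p], inverting it modulo [p] would put [x] in the span of
   [b]. *)
have [u [v uvL]] := int_bezout L p_pr Na0.
case: xN; exists (fun i => - u * a i.+1), (u%:~R * z + v%:~R * x).
  by apply: ringIntD; apply: ringIntM => //; exact: ringInt_int.
rewrite mulrDr mulrCA -aE; transitivity ((u%:~R * (a 0%N)%:~R + v%:~R * p%:R) * x).
  by rewrite uvL mul1r.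
have -> : comb b (fun i => - u * a i.+1) = - u%:~R * comb b (fun i => a i.+1).
  rewrite /comb mulr_sumr; apply: eq_bigr => i _.
  by rewrite rmorphM rmorphN mulrA.
by ring.
Qed.

Lemma residues_exist (N : nat) : (0 < N)%N -> exists s, residues N s.
Proof.
elim/ltn_ind: N => N IH N_gt0; have [N1 | N_gt1] := leqP N 1.
  have -> : N = 1%N by lia.
  exists [:: 0]; split; first by move=> x; rewrite inE => /eqP->; exact: ringInt0.
  by move=> x Ox; exists 0; rewrite ?inE //; exists x; rewrite // add0r mul1r.
have p_pr := pdiv_prime N_gt1; have /dvdnP[m NE] := pdiv_dvd N.
have p_gt1 := prime_gt1 p_pr.
have [s [sO sP]] := residues_prime p_pr.
have [||t [tO tP]] := IH m; [nia | nia |].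
exists [seq y + (pdiv N)%:R * z | y <- s, z <- t]; split.
  move=> _ /allpairsP[[y z] /= [/sO Oy /tO Oz ->]].
  by apply: ringIntD => //; apply: ringIntM => //; exact: ringInt_nat.
move=> x /sP[y sy [z /tP[w tw [v Ov ->]] ->]].
exists (y + (pdiv N)%:R * w); first by apply/allpairsP; exists (y, w).
have NR : N%:R = m%:R * (pdiv N)%:R :> L by rewrite -natrM -NE.
by exists v => //; rewrite NR; ring.
Qed.

End Residues.

(** * Maximal ideals and invertibility of nonzero ideals *)

Section Dedekind.
Variables (L : fieldExtType rat) (M : {subfield L}).
Implicit Types (I J P : set L) (x y : L) (N : nat).

Local Notation O := (ringInt M).

Lemma submodN I x : submod M I -> I x -> I (- x).
Proof.
by move=> [_ _ IZ] Ix; rewrite -mulN1r; apply: IZ => //; exact: (ringInt_int M (- 1)).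
Qed.

Lemma submodB I x y : submod M I -> I x -> I y -> I (x - y).
Proof. by move=> sI Ix Iy; have [_ ID _] := sI; apply: ID => //; exact: submodN. Qed.

Lemma ringInt_ideal : ideal M O.
Proof. by split=> //; split; [exact: ringInt0 | exact: ringIntD | exact: ringIntM]. Qed.

Lemma ideal1 I : ideal M I -> I 1 -> I = O.
Proof.
move=> [IO [_ _ IZ]] I1; apply/seteqP; split=> // x Ox.
by rewrite -[x]mulr1; exact: IZ.
Qed.

Lemma ideal_nat I x : ideal M I -> I x -> x != 0 -> exists2 N, (0 < N)%N & I N%:R.
Proof.
move=> [IO [_ _ IZ]] Ix x0; have [y Oy [N N0 xyN]] := ringInt_norm (IO _ Ix) x0.
by exists N => //; rewrite -xyN mulrC; exact: IZ.
Qed.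

Lemma ltn_count (T : eqType) (a b : pred T) (s : seq T) (y : T) :
  subpred a b -> y \in s -> b y -> ~~ a y -> (count a s < count b s)%N.
Proof.
move=> ab + yb ya; elim: s => //= z s IH; rewrite inE => /predU1P[<-|/IH H].
  by rewrite yb (negPf ya) add0n add1n ltnS; exact: sub_count.
by rewrite -addnS leq_add //; case: (boolP (a z)) => [/ab->|].
Qed.

(** An ideal containing [N] is a union of classes modulo [N]. The number of listed representatives
    it contains grows strictly along proper inclusions and is at most [size s]. *)
Lemma noether N (Q : set L -> Prop) I : (0 < N)%N -> ideal M I -> I N%:R -> Q I ->
  exists J, [/\ ideal M J, I `<=` J, Q J &
    forall H, ideal M H -> J `<=` H -> Q H -> H = J].
Proof.
move=> N_gt0 + IN; have [s [sO sP]] := residues_exist M N_gt0.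
have [n] := ubnP (size s - count (fun y => `[< I y >]) s).
elim: n I IN => // n IH I IN In iI QI.
have [|] := pselect (forall H, ideal M H -> I `<=` H -> Q H -> H = I).
  by move=> Imax; exists I; split.
move=> /existsNP[H /not_implyP[iH /not_implyP[IH' /not_implyP[QH HI]]]].
have [x Hx Ix] : exists2 x, H x & ~ I x.
  apply: contra_notP HI => /forall2NP HI; apply/seteqP; split=> // x Hx.
  by have [|/contrapT] := HI x.
have [[IO [_ ID IZ]] [HO Hsub]] := (iI, iH).
have [y sy [z Oz xE]] := sP x (HO _ Hx).
have INz : I (N%:R * z) by rewrite mulrC; exact: IZ.
have [||||J [iJ HJ QJ Jmax]] := IH H; rewrite //.
  exact: IH'.
  have lt_IH : (count (fun y => `[< I y >]) s < count (fun y => `[< H y >]) s)%N.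
    apply: (@ltn_count _ _ _ _ y) => //.
    - by move=> w /asboolP Iw; apply/asboolP; exact: IH'.
    - apply/asboolP; rewrite -(addrK (N%:R * z) y) -xE.
      by apply: submodB => //; exact: IH'.
    - by apply/asboolPn => Iy; apply: Ix; rewrite xE; exact: ID.
  have le_H := count_size (fun y => `[< H y >]) s.
  move: In lt_IH le_H; lia.
by exists J; split=> //; exact: subset_trans HJ.
Qed.

Lemma ideal_le_max N I : (0 < N)%N -> ideal M I -> I N%:R -> ~ I 1 ->
  exists2 P, maxIdeal M P & I `<=` P.
Proof.
move=> N_gt0 iI IN I1.
have [P [iP IP P1 Pmax]] := noether (Q := fun J => ~ J 1) N_gt0 iI IN I1.
exists P => //; split=> //; first by move=> PO; apply: P1; rewrite PO; exact: ringInt1.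
move=> J iJ PJ; have [J1|J1] := pselect (J 1); last by left; exact: Pmax.
by right; exact: ideal1.
Qed.

Lemma max_n1 P : maxIdeal M P -> ~ P 1.
Proof. by move=> [iP PO _] P1; apply: PO; exact: ideal1. Qed.

Lemma max_inv P x : maxIdeal M P -> O x -> ~ P x -> exists2 u, O u & P (1 - u * x).
Proof.
move=> [[PO [P0 PD PZ]] _ Pmax] Ox Px.
pose J := [set z | exists a, exists2 b, O b & P a /\ z = a + b * x].
have iJ : ideal M J.
  split; first by move=> _ [a [b Ob [Pa ->]]]; apply: ringIntD; [exact: PO | exact: ringIntM].
  split.
  - by exists 0, 0; [exact: ringInt0 | rewrite mul0r addr0].
  - move=> _ _ [a [b Ob [Pa ->]]] [c [d Od [Pc ->]]]; exists (a + c), (b + d).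
      exact: ringIntD.
    by split; [exact: PD | ring].
  - move=> e _ Oe [a [b Ob [Pa ->]]]; exists (e * a), (e * b); first exact: ringIntM.
    by split; [exact: PZ | ring].
have PJ : P `<=` J by move=> a Pa; exists a, 0; rewrite ?mul0r ?addr0 //; exact: ringInt0.
have [JP|JO] := Pmax J iJ PJ.
  by case: Px; rewrite -JP; exists 0, 1; rewrite ?mul1r ?add0r //; exact: ringInt1.
have [a [b Ob [Pa bE]]] : J 1 by rewrite JO; exact: ringInt1.
by exists b; rewrite // bE addrK.
Qed.

Lemma max_prime P x y : maxIdeal M P -> O x -> O y -> P (x * y) -> P x \/ P y.
Proof.
move=> mP Ox Oy Pxy; have [|Px] := pselect (P x); first by left.
have [u Ou Pu] := max_inv mP Ox Px; have [[_ [P0 PD PZ]] _ _] := mP; right.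
rewrite (_ : y = y * (1 - u * x) + u * (x * y)); last by ring.
by apply: PD; exact: PZ.
Qed.

Lemma max_primeX P x n : maxIdeal M P -> O x -> P (x ^+ n) -> P x.
Proof.
move=> mP Ox; elim: n => [|n IH]; first by move/(max_n1 mP).
by rewrite exprS => /(max_prime mP)[] //; exact: ringIntX.
Qed.

Lemma residue_repeat N (f : nat -> L) : (0 < N)%N -> (forall i, O (f i)) ->
  exists i j, (i < j)%N /\ exists2 z, O z & f j - f i = N%:R * z.
Proof.
move=> N_gt0 fO; have [s [sO sP]] := residues_exist M N_gt0.
have /choice[g gP] : forall i, exists y, y \in s /\ exists2 z, O z & f i = y + N%:R * z.
  by move=> i; have [y ? ?] := sP _ (fO i); exists y.
have : ~~ uniq [seq g i | i <- iota 0 (size s).+1].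
  apply: contraL (leqnn (size s)) => /uniq_leq_size gs; rewrite -ltnNge.
  have := gs s; rewrite size_map size_iota; apply=> _ /mapP[i _ ->].
  by case: (gP i).
move/(uniqPn 0) => [i [j [ij]]]; rewrite size_map size_iota => jn.
have i_n := ltn_trans ij jn.
rewrite !(nth_map 0%N) ?size_iota // !nth_iota // !add0n => gij.
exists i, j; split=> //.
have [[_ [z Oz ->]] [_ [w Ow ->]]] := (gP j, gP i).
by exists (z - w); [exact: ringIntB | rewrite gij; ring].
Qed.

(** The powers of an element [x] outside [I] repeat modulo [N], so [I] contains some x^i (x^m - 1)
    with m > 0. Primality leaves x^m - 1 in [I], that is, [x] is a unit modulo [I]. *)
Lemma prime_max N I : (0 < N)%N -> ideal M I -> I N%:R -> ~ I 1 ->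
  (forall x y, O x -> O y -> I (x * y) -> I x \/ I y) -> maxIdeal M I.
Proof.
move=> N_gt0 iI IN I1 Iprime; have [IO [I0 ID IZ]] := iI.
split=> //; first by move=> IE; apply: I1; rewrite IE; exact: ringInt1.
move=> J iJ IJ; have [JI|] := pselect (J `<=` I); first by left; apply/seteqP.
move=> /existsNP[x /not_implyP[Jx Ix]]; right; apply: ideal1 => //.
have [JO sJ] := iJ; have Ox := JO _ Jx.
have [i [j [ij [z Oz]]]] := residue_repeat N_gt0 (fun i => @ringIntX _ M i x Ox).
have IX n : ~ I (x ^+ n).
  by elim: n => // n IH; rewrite exprS => /Iprime[] //; exact: ringIntX.
rewrite -(subnKC ij) addSnnS exprD -{2}[x ^+ i]mulr1 -mulrBr => /esym IE.
have : I (x ^+ i * (x ^+ (j - i.+1).+1 - 1)) by rewrite -IE mulrC; exact: IZ.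
move=> /Iprime[||/IX//|I1x]; first exact: ringIntX.
  by apply: ringIntB; [exact: ringIntX | exact: ringInt1].
rewrite -(subKr (x ^+ (j - i.+1).+1) 1); apply: submodB => //; last exact: IJ.
by have [_ _ JZ] := sJ; rewrite exprSr; apply: JZ => //; exact: ringIntX.
Qed.

Lemma max_nat P : maxIdeal M P -> exists2 N, (0 < N)%N & P N%:R.
Proof.
move=> mP; have [iP PO Pmax] := mP; have [PsO sP] := iP.
have [[x Px x0]|/forall2NP P0] := pselect (exists2 x, P x & x != 0).
  exact: ideal_nat Px x0.
(* The zero ideal is not maximal: [J] lies strictly between it and [O], as 1/2 is not integral. *)
pose J := [set 2%:R * x | x in O].
have iJ : ideal M J.
  split; first by move=> _ [x Ox <-]; apply: ringIntM => //; exact: ringInt_nat.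
  split; first by exists 0; [exact: ringInt0 | rewrite mulr0].
  - by move=> _ _ [x Ox <-] [y Oy <-]; exists (x + y); [exact: ringIntD | rewrite mulrDr].
  - by move=> a _ Oa [x Ox <-]; exists (a * x); [exact: ringIntM | rewrite mulrCA].
have J2 : J 2%:R by exists 1; [exact: ringInt1 | rewrite mulr1].
have nz2 : 2%:R != 0 :> L by rewrite natrL_eq0.
have [|JP|JO] := Pmax J iJ.
- move=> x Px; have [//|/negP/negPn/eqP->] := P0 x.
  by exists 0; [exact: ringInt0 | rewrite mulr0].
- by have [P2|/(_ nz2)] := P0 2%:R; [case: P2; rewrite -JP | ].
have [x Ox xE] : J 1 by rewrite JO; exact: ringInt1.
case: (@ringInt_Vnat _ M 2) => //.
by have -> : 2%:R^-1 = x by apply: (mulfI nz2); rewrite mulfV.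
Qed.

Lemma max_prime_nat P : maxIdeal M P -> exists2 p : nat, prime p & P p%:R.
Proof.
move=> mP; have [N] := max_nat mP; elim/ltn_ind: N => N IH N_gt0 PN.
have N_gt1 : (1 < N)%N.
  by case: N N_gt0 PN {IH} => // -[] // _ /(max_n1 mP).
have p_pr := pdiv_prime N_gt1; have /dvdnP[m NE] := pdiv_dvd N.
move: (PN); rewrite NE natrM => /(max_prime mP)[||Pm|]; try exact: ringInt_nat.
- by apply: (IH m) => //; have := prime_gt1 p_pr; nia.
- by exists (pdiv N).
Qed.

(** A pigeonhole argument in place of a determinant: all [c ^+ i * N%:R] lie in [I], so two of them
    agree modulo [N]. Then [c ^+ j - c ^+ i] is some integral [z], and [c] is a root of a monic
    polynomial with integral coefficients. *)
Lemma stable_integral N I c : (0 < N)%N -> ideal M I -> I N%:R -> c \in M ->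
  (forall x, I x -> I (c * x)) -> O c.
Proof.
move=> N_gt0 [IO [I0 ID IZ]] IN cM cI; split=> //.
have nz : N%:R != 0 :> L by rewrite natrL_eq0 -lt0n.
have IX i : I (c ^+ i * N%:R).
  by elim: i => [|i IH]; rewrite ?expr0 ?mul1r // exprS -mulrA; exact: cI.
have [i [j [ij [z [_ Oz] zE]]]] := residue_repeat N_gt0 (fun i => IO _ (IX i)).
have {}zE : c ^+ j - c ^+ i = z.
  by apply: (mulfI nz); rewrite -zE; ring.
pose p : {poly L} := 'X^j - ('X^i + z%:P).
have szp : (size ('X^i + z%:P)%R < size ('X^j : {poly L})%R)%N.
  rewrite size_polyXn (leq_ltn_trans (size_polyD _ _)) // size_polyXn gtn_max ltnS ij.
  by rewrite (leq_ltn_trans (size_polyC_leq1 _)) //; lia.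
apply: (@integral_root_monic _ _ _ _ p).
- by rewrite monicE lead_coefDl ?size_polyN // lead_coefXn.
- by rewrite /root !hornerE opprD addrA zE subrr.
- move=> _ /(nthP 0)[k _ <-]; rewrite coefB coefD !coefXn coefC.
  apply: integral_sub; first exact: integral_nat.
  apply: integral_add; first exact: integral_nat.
  by case: ifP => // _; exact: integral0.
Qed.

Lemma colon_submod I : submod M (colon M I).
Proof.
split.
- by split=> [|y _]; [exact: mem0v | rewrite mul0r; exact: ringInt0].
- move=> x y [xM xI] [yM yI]; split; first exact: rpredD.
  by move=> z Iz; rewrite mulrDl; apply: ringIntD; [exact: xI | exact: yI].
- move=> a x Oa [xM xI]; split; first by case: Oa => aM _; exact: rpredM.
  by move=> z Iz; rewrite -mulrA; apply: ringIntM => //; exact: xI.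
Qed.

Lemma colon_frac N I : (0 < N)%N -> I N%:R -> fracIdeal M (colon M I).
Proof.
move=> N_gt0 IN; split; [by move=> x [] | exact: colon_submod | ].
exists N%:R; split; [exact: ringInt_nat | by rewrite natrL_eq0 -lt0n | ].
by move=> x [_ xI]; rewrite mulrC; exact: xI.
Qed.

Lemma ideal_frac I : ideal M I -> fracIdeal M I.
Proof.
move=> [IO sI]; split=> //; first by move=> x /IO[].
by exists 1; split; [exact: ringInt1 | exact: oner_neq0 | move=> x; rewrite mul1r; exact: IO].
Qed.

(* [a/p] multiplies [P] into [O] when [P] is the annihilator of [a] modulo [p];
   a maximal annihilator contained in [P] is prime, hence equal to [P]. *)
Lemma max_colon P : maxIdeal M P -> exists2 c, colon M P c & ~ O c.
Proof.
move=> mP; have [p p_pr Pp] := max_prime_nat mP; have p_gt0 := prime_gt0 p_pr.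
have [[PO [P0 PD PZ]] PnO Pmax] := mP.
have p0 : p%:R != 0 :> L by rewrite natrL_eq0 -lt0n.
pose ann a := [set x | O x /\ O (x * a / p%:R)].
have iann a : O a -> ideal M (ann a).
  move=> Oa; split; first by move=> x [].
  split.
  - by split; rewrite ?mul0r; exact: ringInt0.
  - move=> x y [Ox Oxa] [Oy Oya]; split; first exact: ringIntD.
    by rewrite !mulrDl; exact: ringIntD.
  - move=> b x Ob [Ox Oxa]; split; first exact: ringIntM.
    by rewrite -!mulrA; apply: ringIntM; rewrite ?mulrA.
have annp a : O a -> ann a p%:R.
  by move=> Oa; split; [exact: ringInt_nat | rewrite mulrAC divff ?mul1r].
pose Q I := exists2 a, O a & I = ann a /\ I `<=` P.
have [|I [iI _ [a Oa [IE IP]] Imax]] :=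
    @noether p Q _ p_gt0 (iann 1 (ringInt1 M)) (annp 1 (ringInt1 M)).
  exists 1; [exact: ringInt1 | split=> // x [_]]; rewrite mulr1 => Ox.
  by rewrite -(divfK p0 x); exact: PZ.
have ann_mul z : O z -> ann a `<=` ann (z * a).
  move=> Oz x [Ox Oxa]; split=> //.
  by rewrite mulrCA -mulrA; exact: ringIntM.
have annE z : O z -> ann (z * a) `<=` P -> ann (z * a) = ann a.
  move=> Oz zP; rewrite -[RHS]IE; apply: Imax; first by apply: iann; exact: ringIntM.
    by rewrite IE; exact: ann_mul.
  by exists (z * a); [exact: ringIntM | split].
have I1 : ~ I 1 by move=> /IP; exact: max_n1.
have mI : maxIdeal M I.
  apply: (prime_max p_gt0) => //; first by rewrite IE; exact: annp.
  move=> x y Ox Oy; rewrite IE => -[Oxy Oxya].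
  have [xaP|] := pselect (ann (x * a) `<=` P).
    right; rewrite -(annE x) //; split=> //.
    by rewrite mulrA [y * x]mulrC.
  move=> /existsNP[z /not_implyP[[Oz Ozxa] Pz]]; left.
  rewrite -(annE z) //; first by split; rewrite // mulrA [x * z]mulrC -(mulrA z).
  move=> w [Ow Owza]; have /IP Pwz : I (w * z).
    by rewrite IE; split; [exact: ringIntM | rewrite -(mulrA w)].
  by have [] := max_prime mP Ow Oz Pwz.
have PI : P = I.
  by have [[iP _ _] [_ _ Imax']] := (mP, mI); case: (Imax' P iP IP).
exists (a / p%:R).
  split; first by rewrite rpred_div ?rpred_nat //; case: Oa.
  by move=> y; rewrite PI IE => -[_]; rewrite [y * a]mulrC mulrAC.
by move=> Oap; apply: I1; rewrite IE; split; [exact: ringInt1 | rewrite mul1r].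
Qed.

Lemma idmul_sub I J H : submod M H -> (forall x y, I x -> J y -> H (x * y)) ->
  idmul I J `<=` H.
Proof. by move=> [H0 HD _]; exact: idmul_min. Qed.

(** The product of [P] and [colon M P] is an ideal between [P] and [O]. If it were [P], every
    element of [colon M P] would stabilise [P] and so be integral, against [max_colon]. *)
Lemma max_invertible P : maxIdeal M P -> invertible M P.
Proof.
move=> mP; have [N N_gt0 PN] := max_nat mP; have [iP PnO Pmax] := mP.
have [c [cM cP] Oc] := max_colon mP.
have fP := ideal_frac iP; have fC := colon_frac N_gt0 PN.
have iPC : ideal M (idmul P (colon M P)).
  split; last by have [_ + _] := fracIdealM fP fC.
  apply: idmul_sub; first by case: (ringInt_ideal).
  by move=> x y Px [_ yP]; rewrite mulrC; exact: yP.
split=> //; exists (colon M P) => //.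
have PPC : P `<=` idmul P (colon M P).
  move=> x Px; rewrite -[x]mulr1; apply: idmul_mem => //; split; first exact: mem1v.
  by move=> y Py; rewrite mul1r; have [PO _] := iP; exact: PO.
have [PE|//] := Pmax _ iPC PPC; case: Oc.
apply: (stable_integral N_gt0 iP PN cM) => x Px.
by rewrite -PE mulrC; apply: idmul_mem.
Qed.

(** A maximal non-invertible ideal [J] lies in some maximal [P]. Its product with the inverse of [P]
    contains [J] and is not invertible either, hence equals [J]; then the inverse of [P] stabilises
    [J], against [max_colon]. *)
Lemma ideal_invertible I x : ideal M I -> I x -> x != 0 -> invertible M I.
Proof.
move=> iI Ix x0; have [N N_gt0 IN] := ideal_nat iI Ix x0.
apply: contrapT => nI.
have [J [iJ IJ nJ Jmax]] := noether (Q := fun J => ~ invertible M J) N_gt0 iI IN nI.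
have JN := IJ _ IN.
have [J1|/(ideal_le_max N_gt0 iJ JN)[P mP JP]] := pselect (J 1).
  by apply: nJ; rewrite (ideal1 iJ J1); exact: invertible1.
have [iP _ _] := mP; have invP := max_invertible mP.
have [invC CP] := invertibleV invP; have fC := invC.1.
have [c cC Oc] := max_colon mP.
have iJC : ideal M (idmul J (colon M P)).
  split; last by have [_ + _] := fracIdealM (ideal_frac iJ) fC.
  apply: idmul_sub; first by case: (ringInt_ideal).
  by move=> y z /JP Py [_ zP]; rewrite mulrC; exact: zP.
have JJC : J `<=` idmul J (colon M P).
  move=> y Jy; rewrite -[y]mulr1; apply: idmul_mem => //; split; first exact: mem1v.
  by move=> z Pz; rewrite mul1r; have [PO _] := iP; exact: PO.
have [invJC|nJC] := pselect (invertible M (idmul J (colon M P))).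
  apply: nJ; rewrite -[J](@idmul1 _ M); last by case: iJ.
  by rewrite -CP idmulC idmulA; exact: invertibleM.
apply: Oc; have [cM _] := cC; apply: (stable_integral N_gt0 iJ JN cM) => y Jy.
by rewrite -(Jmax _ iJC JJC nJC) mulrC; exact: idmul_mem.
Qed.

Definition prin x : set L := [set x * y | y in O].

Lemma prin_mem x : prin x x.
Proof. by exists 1; [exact: ringInt1 | rewrite mulr1]. Qed.

Lemma prin_submod x : submod M (prin x).
Proof.
split.
- by exists 0; [exact: ringInt0 | rewrite mulr0].
- by move=> _ _ [y Oy <-] [z Oz <-]; exists (y + z); [exact: ringIntD | rewrite mulrDr].
- by move=> a _ Oa [y Oy <-]; exists (a * y); [exact: ringIntM | rewrite mulrCA].
Qed.

Lemma prin1 : prin 1 = O.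
Proof. by apply/seteqP; split=> [_ [y Oy <-]|y Oy]; [rewrite mul1r | exists y; rewrite ?mul1r]. Qed.

Lemma prinM x y : idmul (prin x) (prin y) = prin (x * y).
Proof.
apply/seteqP; split.
  apply: idmul_sub; first exact: prin_submod.
  move=> _ _ [a Oa <-] [b Ob <-]; exists (a * b); first exact: ringIntM.
  by rewrite mulrACA.
move=> _ [a Oa <-]; rewrite -mulrA; apply: idmul_mem; first exact: prin_mem.
by exists a.
Qed.

Lemma prin_ideal x : O x -> ideal M (prin x).
Proof.
by move=> Ox; split; [move=> _ [y Oy <-]; exact: ringIntM | exact: prin_submod].
Qed.

Lemma prin_invertible x : O x -> x != 0 -> invertible M (prin x).
Proof. by move=> Ox; apply: ideal_invertible (prin_mem x); exact: prin_ideal. Qed.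

Lemma frac_invertible I x : fracIdeal M I -> I x -> x != 0 -> invertible M I.
Proof.
move=> fI Ix x0; have [IM sI [d [Od d0 dI]]] := fI.
have invd := prin_invertible Od d0.
have [invC CE] := invertibleV invd.
have idI : ideal M (idmul (prin d) I).
  have [_ + _] := fracIdealM (ideal_frac (prin_ideal Od)) fI; split=> //.
  apply: idmul_sub; first by case: ringInt_ideal.
  by move=> _ y [a Oa <-] Iy; rewrite mulrAC mulrC; apply: ringIntM => //; exact: dI.
rewrite -[I](@idmul1 _ M) // -CE -idmulA; apply: invertibleM => //.
apply: (ideal_invertible (x := d * x)) => //; last by rewrite mulf_neq0.
by apply: idmul_mem => //; exact: prin_mem.
Qed.

End Dedekind.

(** * The group of fractional ideals and its classes *)

Section FractionalIdeals.
Variables (L : fieldExtType rat) (M : {subfield L}).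
Implicit Types (I J H : fideal M) (x y : L) (n : nat).

Local Notation O := (ringInt M).

(** A set that is not an invertible ideal is sent to the unit ideal. *)
Definition fid (S : set L) : fideal M := insubd (0 : fideal M) S.

Lemma val_fid S : invertible M S -> val (fid S) = S.
Proof. by move=> invS; rewrite insubdK //; exact/asboolP. Qed.

Lemma fideal_subM I x : val I x -> x \in M.
Proof. by have /asboolP[[+ _ _] _] := valP I; apply. Qed.

Lemma fideal_mul I J x y : val I x -> val J y -> val (I + J) (x * y).
Proof. exact: idmul_mem. Qed.

Lemma fideal_invP I x : x \in M -> (forall y, val (- I) y -> O (x * y)) -> val I x.
Proof.
by move=> xM H; have -> : val I = colon M (val (- I)) by rewrite -[in LHS](opprK I).
Qed.

Lemma fideal_exp I x n : val I x -> val (I *+ n) (x ^+ n).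
Proof.
move=> Ix; elim: n => [|n IH]; first exact: ringInt1.
by rewrite mulrS exprS; exact: fideal_mul.
Qed.

Lemma fideal_addl_sub I J H : val I `<=` val J -> val (H + I) `<=` val (H + J).
Proof.
move=> IJ; apply: idmul_sub; first exact: fideal_submod.
by move=> x y Hx /IJ Jy; exact: fideal_mul.
Qed.

(** To contain is to divide: multiplication by an ideal preserves inclusions. *)
Lemma fideal_sub0 I J : val I `<=` val J <-> val (I - J) `<=` O.
Proof.
split=> IJ.
  have -> : O = val (- J + J) by rewrite addNr.
  by rewrite addrC; exact: fideal_addl_sub.
have -> : val I = val (J + (I - J)) by rewrite addrC subrK.
have -> : val J = val (J + 0) by rewrite addr0.
exact: fideal_addl_sub.
Qed.

Lemma fideal_add_sub I1 J1 I2 J2 :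
  val I1 `<=` val J1 -> val I2 `<=` val J2 -> val (I1 + I2) `<=` val (J1 + J2).
Proof.
move=> H1 H2; apply: (@subset_trans _ (val (I1 + J2))); first exact: fideal_addl_sub.
by rewrite ![_ + J2]addrC; exact: fideal_addl_sub.
Qed.

Lemma fideal_sub_mulrn I J n : val I `<=` val J -> val (I *+ n) `<=` val (J *+ n).
Proof.
by move=> IJ; elim: n => // n IH; rewrite !mulrS; exact: fideal_add_sub.
Qed.

Lemma ringInt_root x n : x \in M -> (0 < n)%N -> O (x ^+ n) -> O x.
Proof.
move=> xM n_gt0 [_ xn]; split=> //; apply: (@integral_root_monic _ _ _ _ ('X^n - (x ^+ n)%:P)).
- exact: monicXnsubC.
- by rewrite /root !hornerE subrr.
- move=> _ /(nthP 0)[k _ <-]; rewrite coefB coefXn coefC.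
  apply: integral_sub; first exact: integral_nat.
  by case: ifP => // _; exact: integral0.
Qed.

Lemma fideal_torsion_le I n : (0 < n)%N -> val (I *+ n) `<=` O -> val I `<=` O.
Proof.
move=> n_gt0 InO x Ix; apply: (ringInt_root (fideal_subM Ix) n_gt0).
exact/InO/fideal_exp.
Qed.

(** Both [I] and its inverse consist of elements whose [n]-th powers are integral, hence of integral
    elements. Uniqueness of roots of ideals follows. *)
Lemma fideal_torsion_free I n : (0 < n)%N -> I *+ n = 0 -> I = 0.
Proof.
move=> n_gt0 In0; apply: val_inj; apply/seteqP; split.
  by apply: (fideal_torsion_le n_gt0); rewrite In0.
apply/fideal_sub0; rewrite sub0r; apply: (fideal_torsion_le n_gt0).
by rewrite mulNrn In0 oppr0.
Qed.

Lemma fideal_mulrnI I J n : (0 < n)%N -> I *+ n = J *+ n -> I = J.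
Proof.
move=> n_gt0 /eqP; rewrite -subr_eq0 -mulrnBl => /eqP/(fideal_torsion_free n_gt0)/eqP.
by rewrite subr_eq0 => /eqP.
Qed.

Lemma fideal_neq0 I : exists2 x, val I x & x != 0.
Proof.
apply: contrapT => /forall2NP I0.
have : val (I - I) `<=` [set 0].
  apply: idmul_min => //; first by move=> x y /= -> ->; rewrite addr0.
  move=> x y Ix _ /=; have [//|/negP/negPn/eqP->] := I0 x; by rewrite mul0r.
by rewrite subrr => /(_ 1 (ringInt1 M)) /eqP; rewrite oner_eq0.
Qed.

Lemma fideal_ideal I : val I `<=` O -> ideal M (val I).
Proof. by move=> IO; split=> //; exact: fideal_submod. Qed.

Definition fnat (n : nat) : fideal M := fid (prin M n%:R).

Lemma val_fnat n : (0 < n)%N -> val (fnat n) = prin M n%:R.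
Proof.
move=> n_gt0; apply: val_fid; apply: prin_invertible; first exact: ringInt_nat.
by rewrite natrL_eq0 -lt0n.
Qed.

Lemma fnat1 : fnat 1 = 0.
Proof. by apply: val_inj; rewrite val_fnat // prin1. Qed.

Lemma fnatM m n : (0 < m)%N -> (0 < n)%N -> fnat (m * n) = fnat m + fnat n.
Proof.
move=> m_gt0 n_gt0; apply: val_inj; rewrite val_fnat ?muln_gt0 ?m_gt0 //.
by rewrite natrM -prinM -!val_fnat.
Qed.

Lemma fnatX n k : (0 < n)%N -> fnat (n ^ k) = fnat n *+ k.
Proof.
move=> n_gt0; elim: k => [|k IH]; first exact: fnat1.
by rewrite expnS fnatM ?expn_gt0 ?n_gt0 // IH mulrS.
Qed.

Lemma fnat_sub I n : (0 < n)%N -> val I n%:R -> val (fnat n) `<=` val I.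
Proof.
move=> n_gt0 In; rewrite val_fnat // => _ [x Ox <-].
by have [_ _ IZ] := fideal_submod I; rewrite mulrC; exact: IZ.
Qed.

Lemma fnat_mem n : (0 < n)%N -> val (fnat n) n%:R.
Proof. by move=> n_gt0; rewrite val_fnat //; exact: prin_mem. Qed.

Definition cls I : Cl M := \pi_(Cl M) I.

Lemma clsD I J : cls (I + J) = cls I + cls J.
Proof. by rewrite /cls piE. Qed.

Lemma cls0 : cls 0 = 0.
Proof. by rewrite /cls piE. Qed.

Lemma clsN I : cls (- I) = - cls I.
Proof. by rewrite /cls piE. Qed.

Lemma clsMn I n : cls (I *+ n) = cls I *+ n.
Proof. by elim: n => [|n IH]; rewrite ?cls0 // !mulrS clsD IH. Qed.

Lemma cls_eq0 I :
  cls I = 0 <-> exists a, [/\ a \in M, a != 0 & val I = prin M a].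
Proof.
rewrite -cls0 /cls; split.
  by move/eqP; rewrite -Quotient.idealrBE subr0 => /asboolP.
by move=> H; apply/eqP; rewrite -Quotient.idealrBE subr0; exact/asboolP.
Qed.

Lemma clsP (c : Cl M) : exists I, c = cls I.
Proof. by exists (generic_quotient.repr c); rewrite /cls reprK. Qed.

Lemma cls_fnat n : cls (fnat n) = 0.
Proof.
have [->|n_gt0] := posnP n; last first.
  apply/cls_eq0; exists n%:R; split; first exact: rpred_nat.
    by rewrite natrL_eq0 -lt0n.
  exact: val_fnat.
(* For [n = 0] the zero ideal is not invertible, so [fnat 0] is the unit ideal by default. *)
rewrite /fnat /fid /insubd insubN ?cls0 //; apply/asboolPn => -[f0 [J fJ]].
move/seteqP => [_ /(_ 1 (ringInt1 M))]; suff : idmul (prin M 0%:R) J `<=` [set 0].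
  by move=> H /H /eqP; rewrite oner_eq0.
apply: idmul_min => //; first by move=> x y /= -> ->; rewrite addr0.
by move=> _ y [x _ <-] _; rewrite !mul0r.
Qed.

Lemma fideal_div I J y : (forall u, val (- J) u -> val I (y * u)) -> val (I + J) y.
Proof.
move=> H; suff : val (- J + J) `<=` [set z | val (I + J) (y * z)].
  by rewrite addNr => /(_ 1 (ringInt1 M)) /=; rewrite mulr1.
have [H0 HD _] := fideal_submod (I + J).
apply: idmul_min => /=; first by rewrite mulr0.
  by move=> u v; rewrite mulrDr; exact: HD.
by move=> u v /H Iu Jv; rewrite mulrA; exact: fideal_mul.
Qed.

Lemma fideal_mem_inv I x : x != 0 -> val I x -> val (- I) x^-1 -> val I = prin M x.
Proof.
move=> x0 Ix Ix'; apply/seteqP; split; last first.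
  move=> _ [y Oy <-]; rewrite mulrC.
  by have [_ _ IZ] := fideal_submod I; exact: IZ.
move=> y Iy; exists (y * x^-1); last by rewrite mulrC divfK.
by have : val (I - I) (y * x^-1); [exact: fideal_mul | rewrite subrr].
Qed.

End FractionalIdeals.

(** * Extension of ideals and classes to a larger field *)

Section Extension.
Variables (L : fieldExtType rat) (F M : {subfield L}) (FM : (F <= M)%VS).
Implicit Types (I J : fideal F) (x y : L).

Lemma ringInt_ext : ringInt F `<=` ringInt M.
Proof. by move=> x [xF Ox]; split=> //; exact: (subvP FM). Qed.

Lemma ext_invertible (S : set L) : invertible F S -> invertible M (idmul S (ringInt M)).
Proof.
have ext_frac T : fracIdeal F T -> fracIdeal M (idmul T (ringInt M)).
  move=> [TF sT [d [Od d0 dT]]]; split.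
  - apply: idmul_min => [|x y|x y /TF xF [yM _]] /=; first exact: mem0v.
      exact: rpredD.
    by apply: rpredM => //; exact: (subvP FM).
  - split; [exact: idmul0 | exact: idmulD | ].
    by move=> a x Oa; rewrite idmulC; apply: (@idmulZ _ M) => //; case: (ringInt_ideal M).
  - exists d; split=> //; first exact: ringInt_ext.
    apply: (idmul_min (H := [set x | ringInt M (d * x)])) => /=.
    + by rewrite mulr0; exact: ringInt0.
    + by move=> x y ? ?; rewrite mulrDr; exact: ringIntD.
    + by move=> x y Tx Oy; rewrite mulrA; apply: ringIntM => //; exact/ringInt_ext/dT.
move=> [fS [T fT ST]]; split; first exact: ext_frac.
exists (idmul T (ringInt M)); first exact: ext_frac.
have OO : idmul (ringInt M) (ringInt M) = ringInt M by apply: idmul1; case: (ringInt_ideal M).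
rewrite idmulA -(idmulA S) [idmul _ T]idmulC idmulA ST -idmulA OO.
apply/seteqP; split.
  apply: (@idmul_sub _ M); first by case: (ringInt_ideal M).
  by move=> x y /ringInt_ext Ox Oy; exact: ringIntM.
by move=> x Ox; rewrite -[x]mul1r; apply: idmul_mem => //; exact: ringInt1.
Qed.

Definition ext I : fideal M :=
  exist _ (idmul (val I) (ringInt M)) (asboolT (ext_invertible (asboolW (valP I)))).

Fact ext_is_zmod_morphism : {morph ext : I J / I - J}.
Proof.
have extD : {morph ext : I J / I + J}.
  move=> I J; apply: val_inj => /=.
  rewrite -[in LHS](@idmul1 _ M (ringInt M)); last by case: (ringInt_ideal M).
  by rewrite -!idmulA; congr idmul; rewrite [RHS]idmulC -idmulA; congr idmul; rewrite idmulC.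
by move=> I J; rewrite -[in RHS](subrK J I) [in RHS]extD addrK.
Qed.

HB.instance Definition _ :=
  GRing.isZmodMorphism.Build (fideal F) (fideal M) ext ext_is_zmod_morphism.

Lemma ext_sub I x : val I x -> val (ext I) x.
Proof. by move=> Ix; rewrite -[x]mulr1; apply: idmul_mem => //; exact: ringInt1. Qed.

(** Multiplication by [- I] reduces this to the unit ideal, where an element of [F] integral in [M]
    is integral in [F]. Extension of ideals is injective for this reason. *)
Lemma ext_mem I x : x \in F -> val (ext I) x -> val I x.
Proof.
move=> xF Ix; apply: fideal_invP => // y Iy.
split; first by apply: rpredM => //; exact: fideal_subM Iy.
have : val (ext I + ext (- I)) (x * y) by apply: fideal_mul => //; exact: ext_sub.
by rewrite -raddfD subrr raddf0 => -[].
Qed.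

Lemma ext_le I J : val (ext I) `<=` val (ext J) -> val I `<=` val J.
Proof.
by move=> IJ x Ix; apply: ext_mem; [exact: fideal_subM Ix | exact/IJ/ext_sub].
Qed.

Lemma ext_inj : injective ext.
Proof.
by move=> I J IJ; apply: val_inj; apply/seteqP; split; apply: ext_le; rewrite IJ.
Qed.

Lemma ext_prin I a : val I = prin F a -> val (ext I) = prin M a.
Proof.
move=> IE; apply/seteqP; split.
  apply: (@idmul_sub _ M); first exact: prin_submod.
  move=> _ y /[!IE] -[x Ox <-] Oy; exists (x * y); last by rewrite mulrA.
  by apply: ringIntM => //; exact: ringInt_ext.
by move=> _ [y Oy <-]; apply: idmul_mem => //; rewrite IE; exact: prin_mem.
Qed.

Lemma ext_fnat n : (0 < n)%N -> ext (fnat F n) = fnat M n.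
Proof. by move=> n_gt0; apply: val_inj; rewrite val_fnat //; apply: ext_prin; exact: val_fnat. Qed.

Lemma cls_ext I : cls I = 0 -> cls (ext I) = 0.
Proof.
move=> /cls_eq0[a [aF a0 Ia]]; apply/cls_eq0; exists a; split=> //.
  exact: (subvP FM).
exact: ext_prin.
Qed.

Definition clext (c : Cl F) : Cl M := cls (ext (generic_quotient.repr c)).

Lemma clextE I : clext (cls I) = cls (ext I).
Proof.
apply/eqP; rewrite -subr_eq0 -clsN -clsD -raddfB; apply/eqP/cls_ext.
by rewrite clsD clsN /cls reprK subrr.
Qed.

Fact clext_is_zmod_morphism : {morph clext : c d / c - d}.
Proof.
move=> c d; have [[I ->] [J ->]] := (clsP c, clsP d).
by rewrite -clsN -clsD !clextE raddfB clsD clsN.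
Qed.

HB.instance Definition _ :=
  GRing.isZmodMorphism.Build (Cl F) (Cl M) clext clext_is_zmod_morphism.

End Extension.

(** An enumeration makes [V] a finite group; Cauchy's theorem gives one direction, Lagrange's the
    other. This serves both for norms of ideals and for the class number. *)
Lemma zmod_cauchy (V : zmodType) (p : nat) : prime p -> finite_set [set: V] ->
  (p %| #|` fset_set [set: V]|)%N <-> exists2 x : V, x != 0 & x *+ p = 0.
Proof.
move=> p_pr fV; pose s : seq V := fset_set [set: V].
have sV x : x \in s by rewrite in_fset_set //; apply/mem_set.
have s_uniq : uniq s by exact: fset_uniq.
have pk : pcancel (index^~ s) (fun n => if (n < size s)%N then Some (nth 0 s n) else None).
  by move=> x; rewrite index_mem sV nth_index.
have s_enum : Finite.axiom s by move=> x; rewrite count_uniq_mem // sV.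
pose G := HB.pack_for finZmodType V (Choice_isCountable.Build V pk) (isFinite.Build V s_enum).
have -> : #|` fset_set [set: V]| = #|[set: G]%SET|.
  by rewrite cardsT cardT enumT unlock.
split=> [/(Cauchy p_pr)[x _ xp]|[x x0 xp]].
  exists x; last by have := expg_order x; rewrite xp FinRing.zmodXgE.
  apply/eqP => x0; have := prime_gt1 p_pr.
  by rewrite -xp [x](x0 : x = 1%g :> G) order1.
rewrite -(_ : #[x : G]%g = p); first by rewrite order_dvdG ?inE.
have : (#[x : G]%g %| p)%N by rewrite order_dvdn FinRing.zmodXgE xp.
move/(prime_nt_dvdP p_pr) => -> //.
by rewrite order_eq1.
Qed.

(** * Residue groups, norms and avoidance of maximal ideals *)

Section MaximalIdeals.
Variables (L : fieldExtType rat) (M : {subfield L}).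
Implicit Types (I J P Q : set L) (x y : L) (N : nat).

Local Notation O := (ringInt M).

Definition residueClass I x : set L := [set x + y | y in I].

Lemma residueClass_eq I x y : submod M I -> residueClass I x = residueClass I y <-> I (x - y).
Proof.
move=> sI; have [I0 ID IZ] := sI; split.
  move=> xy; have : residueClass I x x by exists 0; rewrite ?addr0.
  by rewrite xy => -[z Iz <-]; rewrite addrC addKr.
move=> Ixy; apply/seteqP; split=> _ [z Iz <-].
  by exists (x - y + z); [exact: ID | ring].
exists (z - (x - y)); first exact: (submodB sI).
by ring.
Qed.

Lemma finite_residueClass N I : (0 < N)%N -> ideal M I -> I N%:R ->
  finite_set [set residueClass I x | x in O].
Proof.
move=> N_gt0 [IO sI] IN; have [s [sO sP]] := residues_exist M N_gt0.
apply: (@sub_finite_set _ _ [set residueClass I x | x in [set` s]]); last first.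
  exact/finite_image/finite_seq.
move=> _ [x Ox <-]; have [y sy [z Oz ->]] := sP x Ox; exists y => //.
apply/(residueClass_eq _ _ sI); rewrite opprD addrA subrr sub0r; apply: (submodN sI).
by have [_ _ IZ] := sI; rewrite mulrC; exact: IZ.
Qed.

Section Quotient.
Variables (I : set L) (iI : ideal M I).

Definition intPred : {pred L} := fun x => `[< O x >].

Fact intPred_zmod_closed : zmod_closed intPred.
Proof.
split; first by apply/asboolP; exact: ringInt0.
by move=> x y /asboolP Ox /asboolP Oy; apply/asboolP; exact: ringIntB.
Qed.

HB.instance Definition _ :=
  GRing.isZmodClosed.Build L intPred intPred_zmod_closed.

Definition ints := {x : L | x \in intPred}.
HB.instance Definition _ := SubChoice.on ints.
HB.instance Definition _ := [SubChoice_isSubZmodule of ints by <:].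

Definition idealPred : {pred ints} := fun x : ints => `[< I (val x) >].

Fact idealPred_zmod_closed : zmod_closed idealPred.
Proof.
have [_ sI] := iI; split; first by apply/asboolP; case: sI.
move=> x y /asboolP Ix /asboolP Iy; apply/asboolP.
by rewrite raddfB; exact: (submodB sI).
Qed.

HB.instance Definition _ :=
  GRing.isZmodClosed.Build ints idealPred idealPred_zmod_closed.

(** The residue classes of [I] correspond to the elements of the quotient of [ints] by [I], so the
    norm is the order of an abelian group. *)
Lemma absNorm_cauchy (p : nat) : prime p -> finite_set [set residueClass I x | x in O] ->
  (p %| absNorm M I)%N <-> exists x, [/\ O x, ~ I x & I (p%:R * x)].
Proof.
move=> p_pr fI; pose V := Quotient.quot idealPred; have [_ sI] := iI.
pose f (c : V) := residueClass I (val (generic_quotient.repr c)).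
have pi_eq (x y : ints) : \pi_V x = \pi_V y <-> I (val x - val y).
  rewrite -raddfB; split; first by move/eqP; rewrite -Quotient.idealrBE => /asboolP.
  by move=> H; apply/eqP; rewrite -Quotient.idealrBE; apply/asboolP.
have fI' : injective f.
  by move=> c d /(residueClass_eq _ _ sI)/pi_eq; rewrite !reprK.
have imf : f @` [set: V] = [set residueClass I x | x in O].
  apply/seteqP; split=> _ [x Ox <-].
    exists (val (generic_quotient.repr x)) => //.
    by apply/asboolP; exact: (valP (generic_quotient.repr x)).
  have Ox' : x \in intPred by apply/asboolP.
  exists (\pi_V (exist _ x Ox')) => //; apply/(residueClass_eq _ _ sI).
  by have /pi_eq := reprK (\pi_V (exist _ x Ox')).
have fV : finite_set [set: V].
  apply: sub_finite_set (finite_preimage (f := f) (in2W fI') fI).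
  by move=> c _; rewrite -imf; exists c.
have -> : absNorm M I = #|` fset_set [set: V]|.
  by rewrite /absNorm -/(residueClass I) -imf fset_set_image // card_imfset.
have pi0 (x : ints) : \pi_V x = 0 <-> I (val x).
  have <- : \pi_V (0 : ints) = 0 by rewrite /V piE.
  by rewrite pi_eq -raddfB subr0.
have valMn (x : ints) : val (x *+ p) = p%:R * val x by rewrite raddfMn mulr_natl.
have piMn (x : ints) : \pi_V (x *+ p) = \pi_V x *+ p.
  elim: (p) => [|n IH]; first by apply/pi0; rewrite mulr0n raddf0; case: sI.
  by rewrite !mulrS -IH /V !piE.
rewrite (zmod_cauchy p_pr fV); split=> [[c c0 pc]|[x [Ox Ix Ipx]]].
  pose x := generic_quotient.repr c; exists (val x); split.
  - by apply/asboolP; exact: (valP x).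
  - by apply: contra_neq_not c0 => /pi0; rewrite /x reprK.
  - by rewrite -valMn; apply/pi0; rewrite piMn /x reprK.
have Ox' : x \in intPred by apply/asboolP.
pose x' : ints := exist _ x Ox'; exists (\pi_V x').
  by apply/eqP => /pi0.
by rewrite -piMn; apply/pi0; rewrite valMn.
Qed.
End Quotient.

(** This reads the residue characteristic off the norm without showing that the norm is a power of
    it: Cauchy's theorem gives [x] outside [P] with [p%:R * x] in [P], and [P] is prime. *)
Lemma dvdn_absNorm P (p : nat) : maxIdeal M P -> prime p ->
  (p %| absNorm M P)%N <-> P p%:R.
Proof.
move=> mP p_pr; have [iP _ _] := mP; have [N N_gt0 PN] := max_nat mP.
rewrite (absNorm_cauchy iP p_pr (finite_residueClass N_gt0 iP PN)); split.
  by move=> [x [Ox Px Ppx]]; have [] := max_prime mP (ringInt_nat M p) Ox Ppx.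
move=> Pp; exists 1; split; [exact: ringInt1 | exact: (max_n1 mP) | by rewrite mulr1].
Qed.

Lemma finite_ideals N : (0 < N)%N -> finite_set [set I | ideal M I /\ I N%:R].
Proof.
move=> N_gt0; have [s [sO sP]] := residues_exist M N_gt0.
pose f (b : {ffun 'I_(size s) -> bool}) := [set x | O x /\
  exists i, b i /\ exists2 z, O z & x = s`_i + N%:R * z].
apply: (@sub_finite_set _ _ (f @` [set: _])); last exact/finite_image/finite_finset.
move=> I [[IO [I0 ID IZ]] IN]; exists [ffun i : 'I_(size s) => `[< I s`_i >]] => //.
apply/seteqP; split=> x.
  move=> [_ [i [+ [z Oz ->]]]]; rewrite ffunE => /asboolP Isi.
  by apply: ID => //; rewrite mulrC; exact: IZ.
move=> Ix; split; first exact: IO.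
have [y sy [z Oz xE]] := sP x (IO _ Ix); have sy' := sy; rewrite -index_mem in sy'.
exists (Ordinal sy'); split; last by exists z; rewrite // nth_index.
rewrite ffunE nth_index //; apply/asboolP.
have -> : y = x + - z * N%:R by rewrite xE; ring.
by apply: ID => //; apply: IZ => //; exact: ringIntN.
Qed.

Lemma finite_above (p : nat) : prime p -> finite_set [set P | maxIdeal M P /\ P p%:R].
Proof.
move=> p_pr; apply: sub_finite_set (finite_ideals (prime_gt0 p_pr)).
by move=> P [[]].
Qed.

Lemma max_sub P Q : maxIdeal M P -> maxIdeal M Q -> P `<=` Q -> P = Q.
Proof.
by move=> [iP _ Pmax] [iQ QO _] PQ; have [|/QO] := Pmax Q iQ PQ.
Qed.

Lemma max_nsub P Q : maxIdeal M P -> maxIdeal M Q -> P <> Q -> exists2 x, P x & ~ Q x.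
Proof.
move=> mP mQ PQ; apply: contra_notP PQ => /forall2NP PQ; apply: max_sub => // x Px.
by have [|/contrapT] := PQ x.
Qed.

Lemma max_separate (s : seq (set L)) P : maxIdeal M P -> P \notin s ->
  (forall Q, Q \in s -> maxIdeal M Q) ->
  exists t, [/\ O t, ~ P t & forall Q, Q \in s -> Q t].
Proof.
move=> mP; elim: s => [|Q s IH] Ps ms.
  by exists 1; split; [exact: ringInt1 | exact: (max_n1 mP) | ].
move: Ps; rewrite inE negb_or => /andP[/eqP PQ Ps].
have [|t [Ot Pt tQ]] := IH Ps; first by move=> R Rs; apply: ms; rewrite inE Rs orbT.
have mQ : maxIdeal M Q by apply: ms; exact: mem_head.
have [u Qu Pu] := max_nsub mQ mP (nesym PQ); have [[QO [_ _ QZ]] _ _] := mQ.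
have Ou := QO _ Qu.
exists (t * u); split; first exact: ringIntM.
  by move=> /(max_prime mP)[].
move=> R; rewrite inE => /predU1P[->|Rs]; first exact: QZ.
have [|[_ [_ _ RZ]] _ _] := ms R; first by rewrite inE Rs orbT.
by rewrite mulrC; apply: RZ => //; exact: tQ.
Qed.

(** Prime avoidance, with [B P] standing for [P] itself or for the product of [P] and [J]. When [x]
    falls in [B P], it is corrected by [t * z], where [t] lies in the maximal ideals already treated
    but not in [P]: this changes nothing modulo their [B Q], and leaves [B P] because [t] is a unit
    modulo [P]. *)
Lemma avoidance (s : seq (set L)) (B : set L -> set L) J : submod M J ->
    (forall P, P \in s -> [/\ maxIdeal M P, submod M (B P),
       forall a x, P a -> J x -> B P (a * x) & exists2 z, J z & ~ B P z]) ->
  exists2 x, J x & forall P, P \in s -> ~ B P x.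
Proof.
move=> [J0 JD JZ]; elim: s => [|P s IH] Bs; first by exists 0.
have [|x Jx xs] := IH; first by move=> Q Qs; apply: Bs; rewrite inE Qs orbT.
have [/xs Px|Ps] := boolP (P \in s).
  by exists x => // Q; rewrite inE => /predU1P[->|/xs].
have [Px|Px] := pselect (B P x); last first.
  by exists x => // Q; rewrite inE => /predU1P[->|/xs].
have [mP sP PB [z Jz Pz]] := Bs P (mem_head _ _).
have [|t [Ot Pt ts]] := max_separate mP Ps.
  by move=> Q Qs; have [|] := Bs Q; rewrite ?inE ?Qs ?orbT.
exists (x + t * z); first by apply: JD => //; exact: JZ.
move=> Q; rewrite inE => /predU1P[->|Qs].
  move=> Bxtz; apply: Pz; have [u Ou Pu] := max_inv mP Ot Pt.
  have [_ BD BZ] := sP.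
  rewrite (_ : z = u * (x + t * z - x) + (1 - u * t) * z); last by ring.
  by apply: BD; [apply: BZ => //; exact: (submodB sP) | exact: PB].
have [|_ sQ QB _] := Bs Q; first by rewrite inE Qs orbT.
move=> Bxtz; apply: (xs Q Qs); rewrite -(addrK (t * z) x).
by apply: (submodB sQ) => //; apply: QB => //; exact: ts.
Qed.

End MaximalIdeals.

(** For infinite [A] the finite set is empty by default and the claim is void. *)
Lemma mem_fset_set (T : choiceType) (A : set T) x : x \in fset_set A -> A x.
Proof.
have [fA|nfA] := pselect (finite_set A); first by rewrite in_fset_set // => /set_mem.
by rewrite /fset_set; case: pselect => // ?; rewrite in_fset0.
Qed.

(** * Generators of the Polya group and the radical of [p] *)

Section Polya.
Variables (L : fieldExtType rat) (M : {subfield L}).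
Implicit Types (P Q : set L) (I J : fideal M) (p q : nat).

Local Notation O := (ringInt M).

Lemma val_fid_max P : maxIdeal M P -> val (fid M P) = P.
Proof. by move=> mP; rewrite val_fid //; exact: max_invertible. Qed.

Definition idealSum (A : set (set L)) : fideal M := \sum_(P <- fset_set A) fid M P.

Lemma val_idealSum (A : set (set L)) : (forall P, A P -> maxIdeal M P) ->
  val (idealSum A) = \big[@idmul L/O]_(P <- fset_set A) P.
Proof.
move=> Amax; rewrite /idealSum.
rewrite (big_morph (val : fideal M -> set L) (id1 := O) (op1 := @idmul L)) //.
rewrite big_seq [RHS]big_seq; apply: eq_bigr => P PA; apply: val_fid_max; apply: Amax.
exact: mem_fset_set.
Qed.

Definition polya q : fideal M := idealSum [set P | maxIdeal M P /\ absNorm M P = q].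

Lemma val_polya q : val (polya q) = PolyaIdeal M q.
Proof. by apply: val_idealSum => P []. Qed.

Lemma PoPred_polya q : (2 <= q)%N -> cls (polya q) \in @PoPred _ M.
Proof.
move=> q_ge2; apply/mem_set => H [_ HG]; apply: HG; exists q => //.
by exists (polya q); rewrite ?val_polya.
Qed.

Lemma PoPred_ind (H : set (Cl M)) : zmod_closed (mem H) ->
  (forall q, (2 <= q)%N -> H (cls (polya q))) -> forall c, c \in @PoPred _ M -> H c.
Proof.
move=> H_closed Hq c /set_mem; apply; split=> // _ [q q_ge2 [I IE ->]].
by rewrite (_ : I = polya q); [exact: Hq | apply: val_inj; rewrite val_polya].
Qed.

(** The maximal ideals are divided out one at a time. The quotient of [I] by [P] still lies in every
    other [Q], since multiplying it by an element of [P] outside [Q] lands in [I], and [Q] is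
    prime. *)
Lemma sub_max_sum (s : seq (set L)) (I : fideal M) : uniq s -> val I `<=` O ->
  (forall P, P \in s -> maxIdeal M P /\ val I `<=` P) ->
  val I `<=` val (\sum_(P <- s) fid M P).
Proof.
elim: s I => [|P s IH] I /=; first by rewrite big_nil.
move=> /andP[Ps s_uniq] IO Is; rewrite big_cons.
have [mP IP] := Is P (mem_head _ _); have vP := val_fid_max mP.
have IPO : val (I - fid M P) `<=` O by apply/fideal_sub0; rewrite vP.
rewrite -[I](subrK (fid M P)) addrC; apply: fideal_addl_sub; apply: IH => // Q Qs.
have [mQ IQ] : maxIdeal M Q /\ val I `<=` Q by apply: Is; rewrite inE Qs orbT.
split=> // x Ix; have [t Pt Qt] : exists2 t, P t & ~ Q t.
  by apply: max_nsub mP mQ _ => PQ; move: Ps; rewrite PQ Qs.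
have Ot : O t by have [[PO _] _ _] := mP; exact: PO.
have : Q (x * t).
  by apply: IQ; rewrite -[I](subrK (fid M P)); apply: fideal_mul => //; rewrite vP.
by move/(max_prime mQ (IPO _ Ix) Ot) => [].
Qed.

Lemma sum_sub_max (s : seq (set L)) P : (forall Q, Q \in s -> maxIdeal M Q) ->
  P \in s -> val (\sum_(Q <- s) fid M Q) `<=` P.
Proof.
move=> ms Ps; rewrite (big_rem P) //= -[X in _ `<=` X](val_fid_max (ms P Ps)).
rewrite -[X in _ `<=` val X]addr0; apply: fideal_addl_sub.
have : forall Q, Q \in rem P s -> maxIdeal M Q by move=> Q /mem_rem/ms.
elim: (rem P s) => [|Q r IH] mr; first by rewrite big_nil.
rewrite big_cons -[X in _ `<=` val X]addr0; apply: fideal_add_sub.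
  by rewrite val_fid_max; [have [[]] := mr Q (mem_head _ _) | exact/mr/mem_head].
by apply: IH => R Rr; apply: mr; rewrite inE Rr orbT.
Qed.

Definition above p : set (set L) := [set P | maxIdeal M P /\ P p%:R].

(** This is the Pi_p(M) of the overview. *)
Definition primeRad p : fideal M := idealSum (above p).

Lemma primeRad_sub p P : prime p -> maxIdeal M P -> P p%:R -> val (primeRad p) `<=` P.
Proof.
move=> p_pr mP Pp; apply: sum_sub_max; first by move=> Q /mem_fset_set[].
by rewrite in_fset_set; [exact/mem_set | exact: finite_above].
Qed.

Lemma sub_primeRad p I : val I `<=` O ->
  (forall P, maxIdeal M P -> P p%:R -> val I `<=` P) -> val I `<=` val (primeRad p).
Proof.
move=> IO IP; apply: sub_max_sum => //; first exact: fset_uniq.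
by move=> P /mem_fset_set[mP Pp]; split=> //; exact: IP.
Qed.

Lemma exists_above p : prime p -> exists2 P, maxIdeal M P & P p%:R.
Proof.
move=> p_pr; have p_gt0 := prime_gt0 p_pr.
have [|P mP pP] := ideal_le_max p_gt0 (prin_ideal (ringInt_nat M p)) (prin_mem M p%:R).
  move=> [x Ox xE]; apply: (@ringInt_Vnat _ M p); first exact: prime_gt1.
  suff -> : p%:R^-1 = x by [].
  by apply: (@mulfI _ p%:R); rewrite ?natrL_eq0 -?lt0n // mulfV // natrL_eq0 -lt0n.
by exists P => //; apply: pP; exact: prin_mem.
Qed.

Lemma primeRad_sub_ringInt p : prime p -> val (primeRad p) `<=` O.
Proof.
move=> p_pr; have [P mP Pp] := exists_above p_pr.
by apply: subset_trans (primeRad_sub p_pr mP Pp) _; have [[]] := mP.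
Qed.

Lemma primeRad_nat p : prime p -> val (primeRad p) p%:R.
Proof.
move=> p_pr; have p_gt0 := prime_gt0 p_pr.
suff : val (fnat M p) `<=` val (primeRad p) by apply; exact: fnat_mem.
apply: sub_primeRad; rewrite val_fnat //.
  by have [] := prin_ideal (ringInt_nat M p).
move=> P [[_ [_ _ PZ]] _ _] Pp _ [x Ox <-]; rewrite mulrC; exact: PZ.
Qed.

Lemma primeRad_n1 p : prime p -> ~ val (primeRad p) 1.
Proof.
by move=> p_pr; have [P mP Pp] := exists_above p_pr; move=> /(primeRad_sub p_pr mP Pp)/(max_n1 mP).
Qed.

Lemma primeRad_neq0 p : prime p -> primeRad p <> 0.
Proof. by move=> p_pr r0; apply: (primeRad_n1 p_pr); rewrite r0; exact: ringInt1. Qed.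

Lemma absNorm_gt1 P : maxIdeal M P -> (1 < absNorm M P)%N.
Proof.
move=> mP; have [p p_pr Pp] := max_prime_nat mP.
have p_gt1 := prime_gt1 p_pr.
have [iP _ _] := mP; have fP := finite_residueClass (prime_gt0 p_pr) iP Pp.
have /dvdn_leq := (dvdn_absNorm mP p_pr).2 Pp; rewrite lt0n.
have [n0|_ /(_ isT)] := eqVneq (absNorm M P) 0%N; last exact: leq_trans.
have : [set residueClass P x | x in O] = set0.
  by apply: fset_set_set0 => //; apply/cardfs0_eq.
by move/seteqP => [/(_ (residueClass P 0)) + _]; case; exists 0; rewrite //; exact: ringInt0.
Qed.

End Polya.

(** * Galois action on ideals *)

Section GaloisAction.
Variables (L : splittingFieldType rat) (M : {subfield L}).
Implicit Types (S I J P Q : set L) (s t : gal_of M) (x y : L).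

Local Notation O := (ringInt M).

Definition galim s S : set L := [set s x | x in S].

Lemma galKV s x : x \in M -> s (s^-1%g x) = x.
Proof. by move=> xM; rewrite -galM // mulVg gal_id. Qed.

Lemma galVK s x : x \in M -> s^-1%g (s x) = x.
Proof. by move=> xM; rewrite -galM // mulgV gal_id. Qed.

Lemma ringInt_gal s x : O x -> O (s x).
Proof.
move=> [xM [p p_monic px]]; split; first exact: memv_gal.
exists p => //; have -> : map_poly intr p = map_poly s (map_poly intr p).
  by rewrite -map_poly_comp; apply: eq_map_poly => z /=; rewrite rmorph_int.
by rewrite fmorph_root.
Qed.

Lemma galimP s S x : S `<=` [set y | y \in M] -> x \in M -> galim s S x <-> S (s^-1%g x).
Proof.
move=> SM xM; split; first by move=> [y Sy <-]; rewrite galVK //; exact: SM.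
by move=> Sx; exists (s^-1%g x) => //; exact: galKV.
Qed.

Lemma galim_mem s S : S `<=` [set y | y \in M] -> galim s S `<=` [set y | y \in M].
Proof. by move=> SM _ [x /SM xM <-]; exact: memv_gal. Qed.

Lemma galimK s S : S `<=` [set y | y \in M] -> galim s^-1%g (galim s S) = S.
Proof.
move=> SM; apply/seteqP; split=> x; last first.
  by move=> Sx; exists (s x); [exists x | rewrite galVK //; exact: SM].
by move=> [_ [y Sy <-] <-]; rewrite galVK //; exact: SM.
Qed.

Lemma galimVK s S : S `<=` [set y | y \in M] -> galim s (galim s^-1%g S) = S.
Proof. by rewrite -{1}[s]invgK; exact: galimK. Qed.

Lemma galim_sub s I J : I `<=` J -> galim s I `<=` galim s J.
Proof. exact: image_subset. Qed.

Lemma ringInt_mem : O `<=` [set y | y \in M].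
Proof. by move=> x []. Qed.

Lemma galim_ringInt s : galim s O = O.
Proof.
apply/seteqP; split; first by move=> _ [x Ox <-]; exact: ringInt_gal.
by move=> x Ox; apply/(galimP s ringInt_mem); [exact: ringInt_mem | exact: ringInt_gal].
Qed.

Lemma galim_submod s I : submod M I -> I `<=` [set y | y \in M] -> submod M (galim s I).
Proof.
move=> [I0 ID IZ] IM; split.
- by exists 0; rewrite ?rmorph0.
- by move=> _ _ [x Ix <-] [y Iy <-]; exists (x + y); [exact: ID | rewrite rmorphD].
- move=> a _ Oa [x Ix <-]; exists (s^-1%g a * x); first by apply: IZ => //; exact: ringInt_gal.
  by rewrite rmorphM /= galKV //; case: Oa.
Qed.

Lemma galim_ideal s I : ideal M I -> ideal M (galim s I).
Proof.
move=> [IO sI]; split; first by rewrite -(galim_ringInt s); exact: galim_sub.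
by apply: galim_submod => // x /IO[].
Qed.

Lemma ideal_mem I : ideal M I -> I `<=` [set y | y \in M].
Proof. by move=> [IO _] x /IO[]. Qed.

Lemma galim_max s P : maxIdeal M P -> maxIdeal M (galim s P).
Proof.
move=> [iP PO Pmax]; split; first exact: galim_ideal.
  by move=> sP; apply: PO; rewrite -(galimK s (ideal_mem iP)) sP galim_ringInt.
move=> J iJ sPJ; have [||H|H] := Pmax (galim s^-1%g J).
- exact: galim_ideal.
- by rewrite -(galimK s (ideal_mem iP)); exact: galim_sub.
- by left; rewrite -H galimVK //; exact: ideal_mem.
- by right; rewrite -(galim_ringInt s) -H galimVK //; exact: ideal_mem.
Qed.

Lemma galim_idmul s I J : galim s (idmul I J) = idmul (galim s I) (galim s J).
Proof.
apply/seteqP; split.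
  move=> _ [x + <-]; apply: (idmul_min (H := fun x => idmul (galim s I) (galim s J) (s x))).
  - by rewrite rmorph0; exact: idmul0.
  - by move=> y z ? ?; rewrite rmorphD; exact: idmulD.
  - by move=> y z Iy Jz; rewrite rmorphM; apply: idmul_mem; [exists y | exists z].
apply: idmul_min.
- by exists 0; [exact: idmul0 | rewrite rmorph0].
- by move=> _ _ [x xIJ <-] [y yIJ <-]; exists (x + y); [exact: idmulD | rewrite rmorphD].
- move=> _ _ [x Ix <-] [y Jy <-]; exists (x * y); last by rewrite rmorphM.
  exact: idmul_mem.
Qed.

Lemma galim_invertible s I : invertible M I -> invertible M (galim s I).
Proof.
have frac J : fracIdeal M J -> fracIdeal M (galim s J).
  move=> [JM sJ [d [Od d0 dJ]]]; split; first exact: galim_mem.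
    exact: galim_submod.
  exists (s d); split; [exact: ringInt_gal | by rewrite fmorph_eq0 | ].
  by move=> _ [x Jx <-]; rewrite -rmorphM; apply: ringInt_gal; exact: dJ.
move=> [fI [J fJ IJ]]; split; first exact: frac.
by exists (galim s J); [exact: frac | rewrite -galim_idmul IJ galim_ringInt].
Qed.

Definition gfid s (I : fideal M) : fideal M :=
  exist _ (galim s (val I)) (asboolT (galim_invertible s (asboolW (valP I)))).

Fact gfid_is_zmod_morphism s : {morph gfid s : I J / I - J}.
Proof.
have gfidD : {morph gfid s : I J / I + J}.
  by move=> I J; apply: val_inj; exact: galim_idmul.
by move=> I J; rewrite -[in RHS](subrK J I) [in RHS]gfidD addrK.
Qed.

HB.instance Definition _ s :=
  GRing.isZmodMorphism.Build (fideal M) (fideal M) (gfid s) (gfid_is_zmod_morphism s).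

Lemma gfid_fnat s n : (0 < n)%N -> gfid s (fnat M n) = fnat M n.
Proof.
move=> n_gt0; apply: val_inj => /=; rewrite val_fnat //; apply/seteqP; split.
  move=> _ [_ [x Ox <-] <-]; exists (s x); first exact: ringInt_gal.
  by rewrite rmorphM rmorph_nat.
move=> _ [x Ox <-]; exists (n%:R * s^-1%g x); first by exists (s^-1%g x) => //; exact: ringInt_gal.
by rewrite rmorphM rmorph_nat /= galKV //; case: Ox.
Qed.

Lemma gfid_sum s (r : seq (set L)) : (forall P, P \in r -> maxIdeal M P) ->
  gfid s (\sum_(P <- r) fid M P) = \sum_(P <- r) fid M (galim s P).
Proof.
move=> mr; rewrite raddf_sum big_seq [RHS]big_seq; apply: eq_bigr => P /mr mP.
apply: val_inj; rewrite [RHS]val_fid_max; last exact: galim_max.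
by rewrite /= val_fid_max.
Qed.

Lemma gfid_idealSum s (A : set (set L)) : (forall P, A P -> maxIdeal M P) ->
  (forall t P, A P -> A (galim t P)) -> gfid s (idealSum M A) = idealSum M A.
Proof.
move=> Amax Ainv; rewrite gfid_sum; last by move=> P /mem_fset_set/Amax.
have [fA|nfA] := pselect (finite_set A); last first.
  rewrite /idealSum; have -> : fset_set A = fset0 by rewrite /fset_set; case: pselect.
  by rewrite !big_seq_fset0.
rewrite -[LHS](big_map (galim s) xpredT (fid M)); apply: perm_big.
have AM P : A P -> P `<=` [set y | y \in M] by move=> /Amax[iP _ _]; exact: ideal_mem.
apply: uniq_perm; last 1 first.
- move=> P; apply/idP/idP.
    move=> /mapP[Q QA ->]; rewrite in_fset_set //; apply/mem_set/Ainv.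
    exact: mem_fset_set QA.
  move=> /mem_fset_set AP; apply/mapP; exists (galim s^-1%g P).
    by rewrite in_fset_set //; apply/mem_set/Ainv.
  by rewrite galimVK //; exact: AM.
- rewrite map_inj_in_uniq ?fset_uniq // => P Q /mem_fset_set/AM PM /mem_fset_set/AM QM sPQ.
  by rewrite -(galimK s PM) sPQ galimK.
- exact: fset_uniq.
Qed.

Lemma gfid_primeRad s p : gfid s (primeRad M p) = primeRad M p.
Proof.
apply: gfid_idealSum; first by move=> P [].
move=> t P [mP Pp]; split; first exact: galim_max.
by exists p%:R; rewrite ?rmorph_nat.
Qed.

Lemma absNorm_galim s P : maxIdeal M P -> absNorm M (galim s P) = absNorm M P.
Proof.
move=> mP; have [iP _ _] := mP; have [N N_gt0 PN] := max_nat mP.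
have fP := finite_residueClass N_gt0 iP PN.
have PM := ideal_mem iP.
have -> : absNorm M (galim s P) =
    #|` fset_set [set galim s C | C in [set residueClass P x | x in O]]|.
  congr #|` fset_set _|; apply/seteqP; split.
    move=> _ [x Ox <-]; have [xM _] := Ox; exists (residueClass P (s^-1%g x)).
      by exists (s^-1%g x) => //; exact: ringInt_gal.
    apply/seteqP; split.
      move=> _ [_ [y Py <-] <-]; rewrite rmorphD /= galKV //.
      by exists (s y) => //; exists y.
    move=> _ [_ [y Py <-] <-]; exists (s^-1%g x + y); first by exists y.
    by rewrite rmorphD /= galKV.
  move=> _ [_ [x Ox <-] <-]; exists (s x); first exact: ringInt_gal.
  apply/seteqP; split.
    move=> _ [_ [y Py <-] <-]; exists (x + y); first by exists y.
    by rewrite rmorphD.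
  move=> _ [_ [y Py <-] <-]; rewrite rmorphD /=.
  by exists (s y) => //; exists y.
rewrite fset_set_image // card_in_imfset // => C D.
have CM E : E \in fset_set [set residueClass P x | x in O] -> E `<=` [set y | y \in M].
  move=> /mem_fset_set[x [xM _] <-] _ [y Py <-]; apply: rpredD => //; exact: PM.
by move=> /CM CM' /CM DM sCD; rewrite -(galimK s CM') sCD galimK.
Qed.

Lemma galNorm_ringInt (F : {subfield L}) x : O x -> O (galNorm F M x).
Proof. by move=> Ox; apply: ringInt_prod => s _; exact: ringInt_gal. Qed.

Hypothesis galM1 : galois 1 M.

(** If [Q] is not conjugate to [P], some [x] in [Q] avoids all conjugates of [P]. Its norm is an
    integer in [Q], hence a multiple of [p], hence in [P]; but no factor [s x] of the norm is in the
    prime ideal [P]. *)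
Lemma max_transitive (p : nat) P Q : prime p -> maxIdeal M P -> maxIdeal M Q ->
  P p%:R -> Q p%:R -> exists s, galim s P = Q.
Proof.
move=> p_pr mP mQ Pp Qp; apply: contrapT => /forallNP nPQ.
have [[iP _ _] [iQ _ _]] := (mP, mQ); have PM := ideal_mem iP.
have [_ sQ] := iQ.
have [R Rr|x Qx xP] := @avoidance _ M [seq galim s P | s : gal_of M] id Q sQ.
  have [s ->] := codomP Rr; have msP := galim_max s mP; have [[_ ssP] _ _] := msP.
  have [sPO _] := galim_ideal s iP; have [QO _] := iQ; have [_ _ sPZ] := ssP.
  split=> //; first by move=> a y sPa /QO Oy; rewrite mulrC; exact: sPZ.
  by apply: (@max_nsub _ M) => // /esym/nPQ.
have Ox : O x by case: iQ => QO _; exact: QO.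
have [z zE] : exists z : int, galNorm 1 M x = z%:~R.
  by apply: (@ringInt_rat _ M); [apply: mem_galNorm => //; case: Ox | exact: galNorm_ringInt].
have Qz : Q z%:~R.
  rewrite -zE /galNorm (bigD1 1%g) ?group1 //= gal_id mulrC.
  have [_ _ QZ] := sQ; apply: QZ => //; apply: ringInt_prod => s _; exact: ringInt_gal.
have [_ _ QZ] := sQ; have [_ QD _] := sQ.
have /dvdzP[w wE] : (p %| z)%Z.
  apply: contrapT => /negP pz; apply: (max_n1 mQ).
  have [u [v <-]] := int_bezout L p_pr pz.
  by apply: QD; apply: QZ => //; exact: ringInt_int.
have : P (galNorm 1 M x).
  rewrite zE wE rmorphM /=; have [_ [_ _ PZ]] := iP; apply: PZ => //; exact: ringInt_int.
suff [] : O (galNorm 1 M x) /\ ~ P (galNorm 1 M x) by [].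
apply: (big_ind (fun y => O y /\ ~ P y)).
- by split; [exact: ringInt1 | exact: (max_n1 mP)].
- by move=> a b [Oa Pa] [Ob Pb]; split; [exact: ringIntM | move/(max_prime mP Oa Ob) => []].
- move=> s _; split; first exact: ringInt_gal.
  move=> Psx; apply: (xP (galim s^-1%g P)); first exact/codom_f.
  by exists (s x) => //; rewrite galVK //; case: Ox.
Qed.

(** The norm of a maximal ideal determines the prime below it, and conjugate ideals have equal
    norms. *)
Lemma polya_primeRad (p : nat) P : prime p -> maxIdeal M P -> P p%:R ->
  polya M (absNorm M P) = primeRad M p.
Proof.
move=> p_pr mP Pp; rewrite /polya /primeRad; congr idealSum; apply/seteqP; split.
  move=> Q [mQ QP]; split=> //; apply/(dvdn_absNorm mQ p_pr); rewrite QP.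
  exact/(dvdn_absNorm mP p_pr).
move=> Q [mQ Qp]; split=> //; have [s <-] := max_transitive p_pr mP mQ Pp Qp.
exact: absNorm_galim.
Qed.

Lemma polya_cases q : polya M q = 0 \/ exists2 p, prime p & polya M q = primeRad M p.
Proof.
have [[P [mP Pq]]|nP] := pselect (exists P, maxIdeal M P /\ absNorm M P = q).
  right; have [p p_pr Pp] := max_prime_nat mP; exists p => //.
  by rewrite -Pq; exact: polya_primeRad.
left; rewrite /polya /idealSum (_ : [set P | _] = set0) ?fset_set0 ?big_seq_fset0 //.
by apply/seteqP; split=> // P PA; case: nP; exists P.
Qed.

Lemma PoPred_primeRad p : prime p -> cls (primeRad M p) \in @PoPred _ M.
Proof.
move=> p_pr; have [P mP Pp] := exists_above M p_pr.
by rewrite -(polya_primeRad p_pr mP Pp); apply/PoPred_polya/absNorm_gt1.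
Qed.

(* An invariant ideal other than [O] lies in one, hence in all, of the
   conjugate maximal ideals over [p], so it can be divided by their product. *)
Lemma invariant_primeRad (p k : nat) (I : fideal M) : prime p -> val I `<=` O ->
  val I (p ^ k)%:R -> (forall s, gfid s I = I) -> exists j, I = primeRad M p *+ j.
Proof.
move=> p_pr IO Ipk Iinv; apply: contrapT => nI.
have pk_gt0 : (0 < p ^ k)%N by rewrite expn_gt0 prime_gt0.
pose Q (S : set L) := exists J : fideal M, [/\ S = val J, forall s, gfid s J = J &
  ~ exists j, J = primeRad M p *+ j].
have [|S [iJ IJ [J [SE Jinv nJ]] Jmax]] := noether (Q := Q) pk_gt0 (fideal_ideal IO) Ipk.
  by exists I.
subst S.
have Jpk := IJ _ Ipk; have [JO _] := iJ.
have [J1|/(ideal_le_max pk_gt0 iJ Jpk)[P mP JP]] := pselect (val J 1).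
  by apply: nJ; exists 0%N; apply: val_inj; rewrite mulr0n; exact: ideal1.
have Pp : P p%:R.
  by apply: (max_primeX mP (n := k)); [exact: ringInt_nat | rewrite -natrX; exact: JP].
have JR : val J `<=` val (primeRad M p).
  apply: sub_primeRad => // P' mP' P'p; have [s <-] := max_transitive p_pr mP mP' Pp P'p.
  by rewrite -(Jinv s) /=; exact: galim_sub.
have JRO : val (J - primeRad M p) `<=` O by exact/fideal_sub0.
have JJR : val J `<=` val (J - primeRad M p).
  apply/fideal_sub0; rewrite opprB addrCA subrr addr0; exact: primeRad_sub_ringInt.
apply: (primeRad_neq0 (M := M) p_pr).
have [[j Jj]|nJR] := pselect (exists j, J - primeRad M p = primeRad M p *+ j).
  by case: nJ; exists j.+1; rewrite mulrS -Jj addrC subrK.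
have : val (J - primeRad M p) = val J.
  apply: Jmax; [exact: fideal_ideal | exact: JJR | exists (J - primeRad M p); split=> // s].
  by rewrite raddfB /= Jinv gfid_primeRad.
by move/val_inj => E; apply: (@addrI _ (J - primeRad M p)); rewrite subrK addr0.
Qed.

End GaloisAction.

(** * Norms of invariant ideals and the kernel of extension *)

Section GaloisNorm.
Variables (L : splittingFieldType rat) (F M : {subfield L}).
Hypotheses (FM : (F <= M)%VS) (galFM : galois F M).
Implicit Types (I J H : fideal M) (P Q : set L) (s t : gal_of M) (x y : L).

Local Notation O := (ringInt M).
Local Notation n := #|'Gal(M / F)%g|.

(** Additivity of the valuation at [P], for elements of least valuation in [J] and [H]: factors [u]
    and [v] from the inverse ideals bring them into [O] outside [P], and [P] is prime. *)
Lemma max_mul_notin P J H y z : maxIdeal M P ->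
  val J y -> ~ val (fid M P + J) y -> val H z -> ~ val (fid M P + H) z ->
  ~ val (fid M P + (J + H)) (y * z).
Proof.
move=> mP Jy Py Hz Pz Pyz; have vP := val_fid_max mP.
have [u Ju Pu] : exists2 u, val (- J) u & ~ P (y * u).
  apply: contrapT => /forall2NP nu; apply: Py; apply: fideal_div => u Ju.
  by rewrite vP; have [|/contrapT] := nu u.
have [v Hv Pv] : exists2 v, val (- H) v & ~ P (z * v).
  apply: contrapT => /forall2NP nv; apply: Pz; apply: fideal_div => v Hv.
  by rewrite vP; have [|/contrapT] := nv v.
have Oyu : val (J - J) (y * u) by exact: fideal_mul.
have Ozv : val (H - H) (z * v) by exact: fideal_mul.
rewrite !subrr in Oyu Ozv.
have : val (fid M P + (J + H) + (- J - H)) (y * z * (u * v)).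
  by apply: fideal_mul => //; exact: fideal_mul.
rewrite -opprD addrK vP mulrACA => /(max_prime mP Oyu Ozv)[//|//].
Qed.

Lemma prod_mem J (r : seq (gal_of M)) x : (forall s, s \in r -> val J (s x)) ->
  val (J *+ size r) (\prod_(s <- r) s x).
Proof.
elim: r => [|s r IH] Jr; first by rewrite big_nil; exact: ringInt1.
rewrite big_cons mulrS; apply: fideal_mul; first exact/Jr/mem_head.
by apply: IH => t tr; apply: Jr; rewrite inE tr orbT.
Qed.

Lemma galNormE x : galNorm F M x = \prod_(s <- enum 'Gal(M / F)%g) s x.
Proof. by rewrite /galNorm big_enum. Qed.

Lemma galNorm_mem J x : (forall s, s \in 'Gal(M / F)%g -> val J (s x)) ->
  val (J *+ n) (galNorm F M x).
Proof. by move=> Jx; rewrite galNormE cardE; apply: prod_mem => s; rewrite mem_enum => /Jx. Qed.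

Lemma ext_gal (I : fideal F) s x : s \in 'Gal(M / F)%g ->
  val (ext FM I) x -> val (ext FM I) (s x).
Proof.
move=> sF; move: x; apply: (idmul_min (H := fun x => val (ext FM I) (s x))).
- by rewrite rmorph0; exact: idmul0.
- by move=> x y ? ?; rewrite rmorphD; exact: idmulD.
- move=> x y Ix Oy; rewrite rmorphM /= (fixed_gal FM) //; last exact: fideal_subM Ix.
  by apply: idmul_mem => //; exact: ringInt_gal.
Qed.

(** If [I] extends to the principal ideal of [a], then the norm of [a] generates [I *+ n]: it lies
    there, and its inverse, the norm of [a^-1], lies in the inverse ideal. *)
Lemma clext_ker (c : Cl F) : clext FM c = 0 -> c *+ n = 0.
Proof.
have [I ->] := clsP c; rewrite clextE => /cls_eq0[a [aM a0 aE]].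
rewrite -clsMn; apply/cls_eq0; exists (galNorm F M a).
have NF x : x \in M -> galNorm F M x \in F by exact: mem_galNorm.
have N0 : galNorm F M a != 0 by rewrite galNorm_eq0.
split=> //; first exact: NF.
have Ia : val (ext FM I) a by rewrite aE; exact: prin_mem.
have Ia' : val (ext FM (- I)) a^-1.
  rewrite raddfN; split; first by rewrite rpredV.
  by move=> _ /[!aE] -[y Oy <-]; rewrite mulKf.
have norm_in (J : fideal F) x : val (ext FM J) x -> val (J *+ n) (galNorm F M x).
  move=> Jx; apply: (ext_mem (FM := FM)); first exact/NF/(fideal_subM Jx).
  by rewrite raddfMn; apply: galNorm_mem => s sF; exact: ext_gal.
apply: fideal_mem_inv => //; first exact: norm_in.
by rewrite -mulNrn -galNormV; exact: norm_in.
Qed.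


(* The ideal of [F] is generated by the norms of the elements of [J]: for
   every maximal [P], [J] has an element [x] avoiding all [s P * J], and then
   [N x] is not in [P * J ^ n]. *)
Lemma norm_ext J : (forall s, s \in 'Gal(M / F)%g -> gfid s J = J) ->
  exists I : fideal F, J *+ n = ext FM I.
Proof.
move=> Jinv; pose A := idmul (ringInt F) [set galNorm F M x | x in val J].
have gJ s x : s \in 'Gal(M / F)%g -> val J x -> val J (s x).
  by move=> /Jinv sJ Jx; have : val (gfid s J) (s x) by [exists x]; rewrite sJ.
have [sJn_0 sJn_D sJn_Z] := fideal_submod (J *+ n).
have AJn : A `<=` val (J *+ n).
  apply: idmul_min => // a _ /(ringInt_ext FM) Oa [x Jx <-].
  by apply: sJn_Z => //; apply: galNorm_mem => s sF; exact: gJ.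
have AF : A `<=` [set x | x \in F].
  apply: idmul_min => /= [|x y|a _ [aF _] [x Jx <-]]; first exact: mem0v.
    exact: rpredD.
  by apply: rpredM => //; apply: mem_galNorm => //; exact: fideal_subM Jx.
have NA x : val J x -> A (galNorm F M x).
  move=> Jx; rewrite -[galNorm _ _ _]mul1r; apply: idmul_mem; first exact: ringInt1.
  by exists x.
have fA : fracIdeal F A.
  split=> //.
    split; [exact: idmul0 | exact: idmulD | move=> a x Oa].
    by apply: (@idmulZ _ F) => //; case: (ringInt_ideal F).
  have /asboolP[[_ _ [d [Od d0 dJ]]] _] := valP (J *+ n).
  have [y Oy [N N_gt0 dy]] := ringInt_norm Od d0.
  exists N%:R; split; [exact: ringInt_nat | by rewrite natrL_eq0 -lt0n | move=> x Ax].
  split; first by apply: rpredM; [exact: rpred_nat | exact: AF].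
  by have [] : O (N%:R * x) by rewrite -dy mulrAC mulrC; apply: ringIntM => //; exact/dJ/AJn.
have [x0 Jx0 x0_neq0] := fideal_neq0 J.
have invA : invertible F A.
  by apply: (frac_invertible fA (NA x0 Jx0)); rewrite galNorm_eq0.
exists (fid F A); set B := ext FM _.
have BE : val B = idmul A O by rewrite /B /= val_fid.
have BJn : val B `<=` val (J *+ n).
  rewrite BE; apply: idmul_min => // x y Ax Oy; rewrite mulrC.
  by apply: sJn_Z => //; exact: AJn.
apply/eqP; rewrite eq_sym -subr_eq0; apply/eqP.
(* The quotient of the two sides is an integral ideal. If proper, it is contained in a maximal [P],
   and all norms of elements of [J] then lie in the product of [P] and [J *+ n]. *)
have CO : val (B - J *+ n) `<=` O by exact/fideal_sub0.
have iC := fideal_ideal CO.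
apply: val_inj; apply: ideal1 => //; apply: contrapT => C1.
have [c Cc c0] := fideal_neq0 (B - J *+ n).
have [N N_gt0 CN] := ideal_nat iC Cc c0.
have [P mP CP] := ideal_le_max N_gt0 iC CN C1.
have [Q Qr|x Jx xP] := @avoidance _ M [seq galim s P | s : gal_of M]
    (fun Q => val (fid M Q + J)) (val J) (fideal_submod J).
  have [s ->] := codomP Qr; have msP := galim_max s mP; have vsP := val_fid_max msP.
  split=> //; first exact: fideal_submod.
    by move=> a y sPa Jy; apply: fideal_mul; rewrite ?vsP.
  apply: contrapT => /forall2NP nQ; apply: (max_n1 msP); rewrite -vsP.
  suff : val (J - J) `<=` val (fid M (galim s P)) by rewrite subrr; apply; exact: ringInt1.
  rewrite -[X in _ `<=` val X](addrK J); apply: fideal_add_sub => // y Jy.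
  by have [|/contrapT] := nQ y.
have sx s : s \in 'Gal(M / F)%g -> ~ val (fid M P + J) (s x).
  move=> sF Psx; apply: (xP (galim s^-1%g P)); first exact/codom_f.
  have mP' := galim_max s^-1%g mP.
  have -> : fid M (galim s^-1%g P) + J = gfid s^-1%g (fid M P + J).
    rewrite raddfD /= (Jinv s^-1%g) ?groupV //; congr (_ + _); apply: val_inj.
    by rewrite val_fid_max //= val_fid_max.
  by exists (s x) => //; rewrite galVK //; exact: fideal_subM Jx.
have Nx (r : seq (gal_of M)) : {subset r <= 'Gal(M / F)%g} ->
    ~ val (fid M P + J *+ size r) (\prod_(s <- r) s x).
  elim: r => [|s r IH] rF.
    by rewrite big_nil mulr0n addr0 val_fid_max //; exact: (max_n1 mP).
  have sF : s \in 'Gal(M / F)%g by apply: rF; exact: mem_head.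
  have rF' : {subset r <= 'Gal(M / F)%g} by move=> t tr; apply: rF; rewrite inE tr orbT.
  rewrite big_cons mulrS; apply: max_mul_notin => //.
  - exact: gJ.
  - exact: sx.
  - by apply: prod_mem => t /rF' tF; exact: gJ.
  - exact: IH.
apply: (Nx (enum 'Gal(M / F)%g)); first by move=> s; rewrite mem_enum.
rewrite -galNormE -cardE.
have : val B (galNorm F M x).
  rewrite BE -[galNorm _ _ _]mulr1; apply: idmul_mem; first exact: NA.
  exact: ringInt1.
rewrite -[B](subrK (J *+ n)); apply: fideal_add_sub => //.
by rewrite val_fid_max.
Qed.

End GaloisNorm.

(** * Ideals of the rational integers and powers of the radical of [p] *)

Section RationalIdeals.
Variable L : fieldExtType rat.

Lemma rational_ideal (I : fideal (1%AS : {subfield L})) :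
  val I `<=` ringInt (1%AS : {subfield L}) -> exists2 m, (0 < m)%N & I = fnat 1%AS m.
Proof.
move=> IO; have iI := fideal_ideal IO; have sI := fideal_submod I.
have [x Ix x0] := fideal_neq0 I.
have exN : exists N, (0 < N)%N && `[< val I N%:R >].
  by have [N N_gt0 IN] := ideal_nat iI Ix x0; exists N; rewrite N_gt0; exact/asboolP.
have [m /andP[m_gt0 /asboolP Im] m_min] := ex_minnP exN.
exists m => //; apply: val_inj; apply/seteqP; split; last exact: fnat_sub.
move=> y Iy; have [z zE] : exists z : int, y = z%:~R.
  by apply: (@ringInt_rat _ 1%AS); [exact: fideal_subM Iy | exact: IO].
rewrite val_fnat //; exists (z %/ m)%Z%:~R; first exact: ringInt_int.
have r_ge0 : (0 <= z %% m)%Z by apply: modz_ge0; lia.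
have [r rE] : exists r : nat, (z %% m)%Z = r by exists `|z %% m|%Z%N; lia.
have r_lt : (r < m)%N by have := ltz_pmod z (d := m); rewrite rE; lia.
have Ir : val I r%:R.
  have -> : r%:R = y - (z %/ m)%Z%:~R * m%:R :> L.
    by rewrite zE {1}(divz_eq z m) rE rmorphD rmorphM /=; ring.
  apply: (submodB sI) => //; have [_ _ IZ] := sI; apply: IZ => //; exact: ringInt_int.
have r0 : r = 0%N.
  apply/eqP; rewrite -leqn0 leqNgt; apply/negP => r_gt0.
  have /m_min : (0 < r)%N && `[< val I r%:R >] by rewrite r_gt0; exact/asboolP.
  by rewrite leqNgt r_lt.
by rewrite zE {2}(divz_eq z m) rE r0 addr0 rmorphM mulrC.
Qed.

End RationalIdeals.

Section RadicalPower.
Variables (L : splittingFieldType rat) (M : {subfield L}).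
Hypothesis galM1 : galois 1 M.

(** The norm to the rationals makes the left side the ideal of an integer [m]. As [p] belongs to the
    radical, [m] divides a power of [p]. *)
Lemma primeRad_pow p : prime p ->
  exists k, primeRad M p *+ #|'Gal(M / 1)%g| = fnat M p *+ k.
Proof.
move=> p_pr; have p_gt0 := prime_gt0 p_pr.
have M1 : ((1%AS : {subfield L}) <= M)%VS by exact: sub1v.
have [s _|I IE] := @norm_ext L 1%AS M M1 galM1 (primeRad M p); first exact: gfid_primeRad.
have RO := @primeRad_sub_ringInt _ M _ p_pr.
have [m m_gt0 mE] : exists2 m, (0 < m)%N & I = fnat 1%AS m.
  apply: rational_ideal; apply: (@ext_le _ _ _ M1 I 0); rewrite -IE raddf0.
  rewrite -[X in _ `<=` val X](mul0rn _ #|'Gal(M / 1)%g|); exact: fideal_sub_mulrn.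
have IE' : primeRad M p *+ #|'Gal(M / 1)%g| = fnat M m by rewrite IE mE ext_fnat.
have : (m %| p ^ #|'Gal(M / 1)%g|)%N.
  have m0 : m%:R != 0 :> L by rewrite natrL_eq0 -lt0n.
  have := fideal_exp #|'Gal(M / 1)%g| (@primeRad_nat _ M _ p_pr).
  rewrite IE' val_fnat // => -[y Oy yE]; apply: (@ringInt_dvdn _ M) => //.
  by rewrite natrX -yE mulrAC mulfV // mul1r.
case/(dvdn_pfactor _ _ p_pr) => k _ mk; exists k.
by rewrite IE' mk fnatX.
Qed.

End RadicalPower.

(** * An ideal whose power of exponent the degree is [p] *)

Section TotallyRamified.
Variables (L : fieldExtType rat) (M : {subfield L}) (p : nat) (q : fideal M).
Hypotheses (p_pr : prime p) (q_pow : q *+ \dim M = fnat M p).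

Local Notation O := (ringInt M).

Lemma ramified_sub : val q `<=` O.
Proof.
apply: (@fideal_torsion_le _ _ _ (\dim M)); first exact: adim_gt0.
rewrite q_pow val_fnat ?prime_gt0 //; by have [] := prin_ideal (ringInt_nat M p).
Qed.

Lemma ramified_le i j : (i <= j)%N -> val (q *+ j) `<=` val (q *+ i).
Proof.
move=> ij; rewrite -(subnKC ij) mulrnDr -[X in _ `<=` val X]addr0.
apply: fideal_addl_sub; rewrite -[X in _ `<=` val X](mul0rn _ (j - i)).
exact/fideal_sub_mulrn/ramified_sub.
Qed.

Lemma ramified_nat : val q p%:R.
Proof.
apply: (@ramified_le 1 (\dim M)); first exact: adim_gt0.
by rewrite q_pow; apply: fnat_mem; exact: prime_gt0.
Qed.

Lemma ramified_n1 : ~ val q 1.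
Proof.
move=> q1; have q0 : q = 0 by apply: val_inj; exact: ideal1 (fideal_ideal ramified_sub) q1.
have p_gt0 := prime_gt0 p_pr.
have : val (0 : fideal M) 1 by exact: ringInt1.
rewrite -(mul0rn _ (\dim M)) -{1}q0 q_pow val_fnat // => -[x Ox xE].
apply: (@ringInt_Vnat _ M p); first exact: prime_gt1.
suff -> : p%:R^-1 = x by [].
have p0 : p%:R != 0 :> L by rewrite natrL_eq0 -lt0n.
by apply: (mulfI p0); rewrite mulfV.
Qed.

(** If [q *+ i] were contained in [q *+ i.+1], cancelling would put 1 in [q]. The choice of 1 for
    [i = 0] makes the corresponding term of a linear relation an integer, which becomes the residue
    of [x]. *)
Lemma ramified_pick i : exists x, [/\ val (q *+ i) x, ~ val (q *+ i.+1) x & i = 0%N -> x = 1].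
Proof.
case: i => [|i]; first by exists 1; split=> //; [exact: ringInt1 | exact: ramified_n1].
have [x qx qx'] : exists2 x, val (q *+ i.+1) x & ~ val (q *+ i.+2) x.
  apply: contrapT => /forall2NP H; apply: ramified_n1.
  suff : val (q *+ i.+1 - q *+ i.+1) `<=` val q by rewrite subrr; apply; exact: ringInt1.
  rewrite -[X in _ `<=` val X](addrK (q *+ i.+1)) -mulrS.
  by apply: fideal_add_sub => // y qy; have [|/contrapT] := H y.
by exists x.
Qed.

Lemma int_coprime_mem (I : fideal M) (a : int) x : ~~ (p %| a)%Z ->
  val I (a%:~R * x) -> val I (p%:R * x) -> val I x.
Proof.
move=> pa Iax Ipx; have [u [v uvL]] := int_bezout L p_pr pa.
have -> : x = u%:~R * (a%:~R * x) + v%:~R * (p%:R * x).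
  by rewrite !mulrA -mulrDl uvL mul1r.
have [_ ID IZ] := fideal_submod I.
by apply: ID; apply: IZ => //; exact: ringInt_int.
Qed.

Lemma dvd_mem (a : int) x i : (p %| a)%Z -> O x -> (i <= \dim M)%N ->
  val (q *+ i) (a%:~R * x).
Proof.
move=> /dvdzP[b ->] Ox id; apply: (ramified_le id); rewrite q_pow val_fnat ?prime_gt0 //.
exists (b%:~R * x); first by apply: ringIntM => //; exact: ringInt_int.
by rewrite rmorphM /= -pmulrn mulrCA mulrA.
Qed.

(* A relation with integral coefficients, not all divisible by [p], between
   [x] and elements [pi i] of [q ^ i] outside [q ^ (i + 1)], [i < dim M], must
   have a coefficient of [x] prime to [p]. *)
Lemma ramified_residue x : O x -> exists z : int, val q (x - z%:~R).
Proof.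
move=> Ox; have /choice[pi piP] := ramified_pick.
have piO i : O (pi i).
  by have [H _ _] := piP i; exact: (@ramified_le 0 i (leq0n _)) H.
have p_gt1 := prime_gt1 p_pr.
have [||a [a_sum [i0 i0_lt i0a]]] := @int_dependent _ M p (x :: mkseq pi (\dim M)) p_gt1.
- move=> y; rewrite inE => /predU1P[->|/mapP[i _ ->]]; first by case: Ox.
  by case: (piO i).
- by rewrite /= size_mkseq.
move: a_sum i0_lt; rewrite /= size_mkseq big_ord_recl /=.
rewrite (eq_bigr (fun i : 'I_(\dim M) => (a i.+1)%:~R * pi i)); last first.
  by move=> i _; rewrite /= add0n nth_mkseq.
move=> a_sum i0_lt; have [sq_0 sq_D sq_Z] := fideal_submod q.
have d_gt0 : (0 < \dim M)%N by exact: adim_gt0.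
have [pa0|pa0] := boolP (p %| a 0%N)%Z; last first.
  have [u [v uvL]] := int_bezout L p_pr pa0.
  exists (- u * a 1%N).
  have qax : val q ((a 0%N)%:~R * x + (a 1%N)%:~R).
    move: a_sum; rewrite (bigD1 (Ordinal d_gt0)) //=.
    have [_ _ /(_ erefl) ->] := piP 0%N; rewrite mulr1 addrA => /eqP.
    rewrite addr_eq0 => /eqP ->; apply: (submodN (fideal_submod q)).
    apply: (big_ind (val q)) => // i inz; apply: sq_Z; first exact: ringInt_int.
    apply: (@ramified_le 1 i); last by case: (piP i).
    by rewrite lt0n; apply: contraNneq inz => iz; apply/eqP/val_inj.
  have -> : x - (- u * a 1%N)%:~R =
      u%:~R * ((a 0%N)%:~R * x + (a 1%N)%:~R) + v%:~R * x * p%:R.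
    have xE : x = (u%:~R * (a 0%N)%:~R + v%:~R * p%:R) * x by rewrite uvL mul1r.
    by rewrite rmorphM rmorphN /= {1}xE; ring.
  apply: sq_D; apply: sq_Z => //; first exact: ringInt_int.
    by apply: ringIntM => //; exact: ringInt_int.
  exact: ramified_nat.
have ex_j : exists j, ~~ (p %| a j)%Z by exists i0.
(* Indices are shifted by one since [x] comes first: [a j.+1] is the coefficient of [pi j]. All
   other terms lie in [q *+ j.+1], the earlier ones as multiples of [p] and the later ones through
   [pi i], so [pi j] would lie there too. *)
have [[|j] aj j_min] := ex_minnP ex_j; first by rewrite pa0 in aj.
have j_lt : (j < \dim M)%N by rewrite -ltnS; apply: leq_ltn_trans i0_lt; exact: j_min.
have [_ nqj _] := piP j; case: nqj; apply: (int_coprime_mem aj); last first.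
  by rewrite [p%:R]pmulrn; apply: dvd_mem.
move: a_sum; rewrite (bigD1 (Ordinal j_lt)) //= addrCA => /eqP.
rewrite addr_eq0 => /eqP ->; have sj := fideal_submod (q *+ j.+1).
have [sj_0 sj_D sj_Z] := sj.
apply: (submodN sj); apply: (sj_D _ _); first exact: dvd_mem.
apply: (big_ind (val (q *+ j.+1))) => // i ij.
have [ij_lt|] := ltnP i j.
  apply: dvd_mem => //; apply: contraTT ij_lt => ai.
  by rewrite -leqNgt -ltnS; exact: j_min.
rewrite leq_eqVlt => /predU1P[ji|ji].
  by case/eqP: ij; apply: val_inj.
apply: sj_Z; first exact: ringInt_int.
by apply: (ramified_le ji); case: (piP i).
Qed.

(** Any [x] outside [q] is congruent modulo [q] to an integer prime to [p], hence is a unit modulo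
    [q]. *)
Lemma ramified_max : maxIdeal M (val q).
Proof.
have iq := fideal_ideal ramified_sub; have [_ [q0 qD qZ]] := iq.
split=> //; first by move=> qO; apply: ramified_n1; rewrite qO; exact: ringInt1.
move=> J iJ qJ; have [Jq|] := pselect (J `<=` val q); first by left; apply/seteqP.
move=> /existsNP[x /not_implyP[Jx qx]]; right; apply: ideal1 => //.
have [JO sJ] := iJ; have [z xz] := ramified_residue (JO _ Jx).
have Jz : J z%:~R.
  by have -> : z%:~R = x - (x - z%:~R) by [ring]; apply: (submodB sJ) => //; exact: qJ.
have pz : ~~ (p %| z)%Z.
  apply: contra_notN qx => /dvdzP[w zE]; rewrite -(subrK z%:~R x); apply: qD => //.
  by rewrite zE rmorphM /=; apply: qZ; [exact: ringInt_int | exact: ramified_nat].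
have [u [v <-]] := int_bezout L p_pr pz.
have [_ JD JZ] := sJ.
by apply: JD; apply: (JZ _ _); try exact: ringInt_int; last exact/qJ/ramified_nat.
Qed.

(** The norm is a positive multiple of [p] because [q] contains [p], and at most [p] because the
    integers below [p] represent all classes. *)
Lemma ramified_absNorm : absNorm M (val q) = p.
Proof.
have mq := ramified_max; have [iq _ _] := mq; have [_ sq] := iq.
have p_gt0 := prime_gt0 p_pr.
have pn : (p %| absNorm M (val q))%N by exact/(dvdn_absNorm mq p_pr)/ramified_nat.
have pn' : (p <= absNorm M (val q))%N by apply: dvdn_leq pn; exact/ltnW/absNorm_gt1.
apply/eqP; rewrite eqn_leq pn' andbT.
have fq := finite_residueClass p_gt0 iq ramified_nat.
have sub : {subset fset_set [set residueClass (val q) x | x in O] <=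
    [seq residueClass (val q) i%:R | i <- iota 0 p]}.
  move=> _ /mem_fset_set[x Ox <-]; have [z xz] := ramified_residue Ox.
  have r_ge0 : (0 <= z %% p)%Z by apply: modz_ge0; lia.
  have [r rE] : exists r : nat, (z %% p)%Z = r by exists `|z %% p|%Z%N; lia.
  have r_lt : (r < p)%N by have := ltz_pmod z (d := p); rewrite rE; lia.
  apply/mapP; exists r; rewrite ?mem_iota //; apply/(residueClass_eq _ _ sq).
  have [_ qD qZ] := sq.
  have -> : x - r%:R = x - z%:~R + (z %/ p)%Z%:~R * p%:R.
    by rewrite {1}(divz_eq z p) rE rmorphD rmorphM /=; ring.
  by apply: qD => //; apply: qZ; [exact: ringInt_int | exact: ramified_nat].
have := uniq_leq_size (fset_uniq _) sub; by rewrite size_map size_iota.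
Qed.

(** A maximal ideal of norm [p] contains [p], hence the power of [q] equal to it, hence [q]. This
    puts the class of [q] in the Polya group without any Galois action on [M]. *)
Lemma ramified_polya : polya M p = q.
Proof.
have mq := ramified_max; rewrite /polya /idealSum.
have -> : [set P | maxIdeal M P /\ absNorm M P = p] = [set val q].
  apply/seteqP; split=> P /=; last by move=> ->; split; last exact: ramified_absNorm.
  move=> [mP Pp]; apply/esym/(max_sub mq mP) => x qx.
  have /(max_primeX mP) : P (x ^+ \dim M); last by apply; exact: ramified_sub.
  have {}Pp : P p%:R by apply/(dvdn_absNorm mP p_pr); rewrite Pp.
  have := fideal_exp (\dim M) qx; rewrite q_pow val_fnat ?prime_gt0 // => -[y Oy <-].
  by have [[_ [_ _ PZ]] _ _] := mP; rewrite mulrC; exact: PZ.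
rewrite fset_set1 big_seq_fset1; apply: val_inj; exact: val_fid_max.
Qed.

End TotallyRamified.

(** Applied to differences, the last hypothesis makes [b] unique, so any choice function is
    additive. Maps that undo an injective homomorphism are obtained in this way. *)
Lemma additive_choice (A B : zmodType) (R : A -> B -> Prop) :
    (forall a, exists b, R a b) ->
    (forall a a' b b', R a b -> R a' b' -> R (a - a') (b - b')) ->
    (forall b, R 0 b -> b = 0) ->
  exists g : {additive A -> B}, forall a, R a (g a).
Proof.
move=> /choice[g gR] RB R0.
have R_uniq a b b' : R a b -> R a b' -> b = b'.
  move=> Rb Rb'; apply/eqP; rewrite -subr_eq0; apply/eqP/R0.
  by rewrite -(subrr a); exact: RB.
have gB : {morph g : x y / x - y}.
  by move=> x y; apply: (R_uniq (x - y)); [exact: gR | exact: RB].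
pose h := HB.pack_for {additive A -> B} g (GRing.isZmodMorphism.Build A B g gB).
by exists h.
Qed.

(** * Torsion consequences of the exact sequence *)

Section TorsionMaps.
Variables (PE PL PK : zmodType) (l : nat) (f : {additive PE -> PL}) (g : {additive PL -> PK}).
Hypotheses (l_odd : odd l) (f_inj : injective f).
Hypothesis f_img : forall x, x *+ 2 = 0 <-> exists y, f y = x.
Hypothesis g_ker : forall x, g x = 0 <-> x *+ 2 = 0.
Hypothesis g_tors : forall x, g x *+ l = 0.

Lemma torsion2_isomorphic : isomorphic (torsion 2 PL) PE.
Proof.
have [||b fb|e eP] := @additive_choice (torsion 2 PL) PE (fun x y => f y = val x).
- by move=> x; apply/f_img/eqP; exact: (valP x).
- by move=> x x' y y' fy fy'; rewrite !raddfB fy fy'.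
- by apply: f_inj; rewrite fb !raddf0.
have fP y : f y \in torsionPred (G := PL) 2 by rewrite unfold_in; apply/eqP/f_img; exists y.
exists e; exists (fun y => Sub (f y) (fP y)) => [x|y].
  by apply: val_inj; rewrite SubK eP.
by apply: f_inj; rewrite eP SubK.
Qed.

(** The kernel of [g] is killed by 2; since [l] is odd, an element killed by both 2 and [l] is
    zero. *)
Lemma odd_torsion_embeds : embeds (torsion l PL) PK.
Proof.
have [||b gb|e eP] := @additive_choice (torsion l PL) PK (fun x c => g (val x) = c).
- by move=> x; exists (g (val x)).
- by move=> x x' c c' <- <-; rewrite !raddfB.
- by rewrite -gb !raddf0.
exists e => x y exy; apply/eqP; rewrite -subr_eq0; apply/eqP; apply: val_inj.
have /g_ker z2 : g (val (x - y)) = 0 by rewrite eP raddfB exy subrr.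
have : val (x - y) *+ l = 0 by apply/eqP; exact: (valP (x - y)).
rewrite raddf0; move: (val (x - y)) z2 => z z2.
by rewrite -(odd_double_half l) l_odd -mul2n mulrnDr mulrnA z2 mul0rn addr0 mulr1n.
Qed.

(** The values of [g] are killed by [l], hence zero, so all of [PL] is in the kernel of [g], which
    is the image of [f]. *)
Lemma torsion_free_isomorphic : (forall c : PK, c *+ l = 0 -> c = 0) -> isomorphic PE PL.
Proof.
move=> K_free; exists f.
have /choice[h hP] : forall x, exists y, f y = x.
  by move=> x; apply/f_img/g_ker/K_free.
by exists h => // y; apply: f_inj.
Qed.

End TorsionMaps.

(** * The fields [E], [K] and [L] *)

Section Dihedral.
Variables (l : nat) (L : splittingFieldType rat) (K E : {subfield L}).
Hypotheses (l_prime : prime l) (l_odd : odd l) (K_deg : \dim K = l)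
  (galL : galois 1 {:L}) (L_deg : #|'Gal({:L} / 1)%g| = l.*2) (E_quadratic : \dim E = 2%N).

Let KL : (K <= {:L})%VS := subvf K.
Let EL : (E <= {:L})%VS := subvf E.

Lemma dim_dihedral : \dim {:L} = l.*2.
Proof. by rewrite -L_deg -(galois_dim galL) /= dimv1 divn1. Qed.

Lemma galois_KL : galois K {:L}.
Proof. by apply: galoisS galL; rewrite sub1v subvf. Qed.

Lemma galois_EL : galois E {:L}.
Proof. by apply: galoisS galL; rewrite sub1v subvf. Qed.

Lemma card_galKL : #|'Gal({:L} / K)%g| = 2%N.
Proof. by rewrite -(galois_dim galois_KL) dim_dihedral K_deg -mul2n mulnK ?prime_gt0. Qed.

Lemma card_galEL : #|'Gal({:L} / E)%g| = l.
Proof. by rewrite -(galois_dim galois_EL) dim_dihedral E_quadratic -muln2 mulnK. Qed.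

Lemma galois_E1 : galois 1 E.
Proof.
have /galois_fixedField <- := galois_EL; apply: normal_fixedField_galois => //.
apply: index2_normal; first by apply: galS; exact: sub1v.
by rewrite -divgS ?galS ?sub1v // card_galEL L_deg -muln2 mulKn ?prime_gt0.
Qed.

Lemma card_galE1 : #|'Gal(E / 1)%g| = 2%N.
Proof. by rewrite -(galois_dim galois_E1) /= dimv1 divn1. Qed.

Local Notation jE := (clext EL).
Local Notation jK := (clext KL).
Local Notation PoL := (@PoPred L {:L}%AS).
Local Notation PoE := (@PoPred L E).
Local Notation PoK := (@PoPred L K).

Lemma Po_quadratic_torsion c : c \in PoE -> c *+ 2 = 0.
Proof.
have [H0 HB] : zmod_closed (mem [set c : Cl E | c *+ 2 = 0]).
  split; first by apply/mem_set; rewrite /= mul0rn.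
  by move=> x y /set_mem /= x2 /set_mem /= y2; apply/mem_set; rewrite /= mulrnBl x2 y2 subrr.
apply: (PoPred_ind (H := [set c : Cl E | c *+ 2 = 0])) => // q q_ge2 /=.
have [->|[p p_pr ->]] := polya_cases galois_E1 q; first by rewrite cls0 mul0rn.
have [k] := primeRad_pow galois_E1 p_pr; rewrite card_galE1 -clsMn => ->.
by rewrite clsMn cls_fnat mul0rn.
Qed.

Lemma jE_inj c : c \in PoE -> jE c = 0 -> c = 0.
Proof.
move=> /Po_quadratic_torsion c2 /(clext_ker galois_EL); rewrite card_galEL => cl.
move: cl; rewrite -(odd_double_half l) l_odd -mul2n mulrnDr mulrnA c2 mul0rn addr0.
by rewrite mulr1n.
Qed.

Lemma jK_inj c : c *+ l = 0 -> jK c = 0 -> c = 0.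
Proof.
move=> cl /(clext_ker galois_KL); rewrite card_galKL => c2.
move: cl; rewrite -(odd_double_half l) l_odd -mul2n mulrnDr mulrnA c2 mul0rn addr0.
by rewrite mulr1n.
Qed.

Lemma primeRad_pow2l p : prime p -> exists k, primeRad {:L}%AS p *+ l.*2 = fnat {:L}%AS p *+ k.
Proof. by move=> p_pr; have [k] := primeRad_pow galL p_pr; rewrite L_deg; exists k. Qed.

(* [ext I] is invariant because its square is, the group of ideals being
   torsion free. *)
Lemma jE_Po c : c \in PoE -> jE c \in PoL.
Proof.
apply: (PoPred_ind (H := [set c : Cl E | jE c \in PoL])) => [|q q_ge2] /=.
  split; first by apply/mem_set; rewrite /= raddf0 rpred0.
  by move=> x y /set_mem /= x2 /set_mem /= y2; apply/mem_set; rewrite /= raddfB rpredB.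
have [->|[p p_pr ->]] := polya_cases galois_E1 q; first by rewrite cls0 raddf0 rpred0.
have [k] := primeRad_pow galois_E1 p_pr; rewrite card_galE1 clextE => rk.
have p_gt0 := prime_gt0 p_pr.
have [||s|j ->] := invariant_primeRad (k := 1) (I := ext EL (primeRad E p)) galL p_pr.
- rewrite -[ringInt _]/(val (0 : fideal {:L}%AS)) -(raddf0 (ext EL)).
  apply: idmul_sub; first exact: fideal_submod.
  move=> x y /(@primeRad_sub_ringInt _ E _ p_pr) Ox Oy.
  by apply: idmul_mem.
- by rewrite expn1; apply: ext_sub; exact: primeRad_nat.
- apply: (@fideal_mulrnI _ _ _ _ 2) => //.
  have re : ext EL (primeRad E p) *+ 2 = fnat {:L}%AS p *+ k.
    by rewrite -raddfMn rk raddfMn /= ext_fnat.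
  by rewrite -raddfMn /= re raddfMn /= gfid_fnat.
- by rewrite clsMn rpredMn // PoPred_primeRad.
Qed.

(** The square of [I] is a power of [p]. Since roots of ideals are unique, [I] inherits integrality
    and Galois invariance from it. *)
Lemma primeRad_mulrn_l p : prime p ->
  exists2 c, c \in PoE & cls (primeRad {:L}%AS p) *+ l = jE c.
Proof.
move=> p_pr; have p_gt0 := prime_gt0 p_pr; have l_gt0 := prime_gt0 l_prime.
have [s _|I] := norm_ext EL galois_EL (J := primeRad {:L}%AS p); first exact: gfid_primeRad.
rewrite card_galEL => IE; have [k kE] := primeRad_pow2l p_pr.
have I2 : I *+ 2 = fnat E p *+ k.
  by apply: (@ext_inj _ _ _ EL); rewrite !raddfMn /= -IE ext_fnat // -mulrnA muln2.
have IO : val I `<=` ringInt E.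
  apply: (@fideal_torsion_le _ _ _ 2) => //; rewrite I2.
  rewrite -fnatX // val_fnat ?expn_gt0 ?p_gt0 //.
  by have [] := prin_ideal (ringInt_nat E (p ^ k)).
have Ipk : val I (p ^ k)%:R.
  rewrite -[I]addr0; suff : val (I + I) `<=` val (I + 0).
    by apply; rewrite -mulr2n I2 -fnatX //; apply: fnat_mem; rewrite expn_gt0 p_gt0.
  exact: fideal_addl_sub.
have [s|j jE'] := invariant_primeRad galois_E1 p_pr IO Ipk.
  apply: (@fideal_mulrnI _ _ _ _ 2) => //.
  by rewrite -raddfMn /= I2 raddfMn /= gfid_fnat.
exists (cls I); last by rewrite -clsMn IE clextE.
by rewrite jE' clsMn rpredMn // PoPred_primeRad //; exact: galois_E1.
Qed.

Lemma primeRad_mulrn_2 p : prime p ->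
  exists2 c, c \in PoK & c *+ l = 0 /\ cls (primeRad {:L}%AS p) *+ 2 = jK c.
Proof.
move=> p_pr; have p_gt0 := prime_gt0 p_pr; have l_gt0 := prime_gt0 l_prime.
have [s _|I] := norm_ext KL galois_KL (J := primeRad {:L}%AS p); first exact: gfid_primeRad.
rewrite card_galKL => IE; have [k kE] := primeRad_pow2l p_pr.
have Il : I *+ l = fnat K p *+ k.
  by apply: (@ext_inj _ _ _ KL); rewrite !raddfMn /= -IE ext_fnat // -mulrnA mul2n.
exists (cls I); last first.
  by rewrite -!clsMn IE clextE Il clsMn cls_fnat mul0rn.
have [/dvdnP[m km]|lk] := boolP (l %| k)%N.
  have -> : I = fnat K p *+ m by apply: (fideal_mulrnI l_gt0); rewrite Il km mulrnA.
  by rewrite clsMn cls_fnat mul0rn rpred0.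
have k_gt0 : (0 < k)%N by rewrite lt0n; apply: contraNneq lk => ->; rewrite dvdn0.
have [u v uv _] := egcdnP l k_gt0; have {}uv : (u * k = v * l + 1)%N.
  by rewrite uv (eqP (_ : coprime k l)) // coprime_sym prime_coprime.
(* With u k = v l + 1, the [l]-th power of this ideal is p^(u k - v l) = p. Then [q *+ k] and [I]
   have the same [l]-th power, hence are equal. *)
pose q := I *+ u - fnat K p *+ v.
have ql : q *+ \dim K = fnat K p.
  rewrite K_deg mulrnBl -!mulrnA mulnC mulrnA Il -mulrnA mulnC uv.
  by rewrite mulrnDr addrC addKr mulr1n.
have <- : q *+ k = I.
  by apply: (fideal_mulrnI l_gt0); rewrite -mulrnA mulnC mulrnA -{1}K_deg ql Il.
rewrite clsMn rpredMn // -(ramified_polya p_pr ql) PoPred_polya //.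
exact: prime_gt1.
Qed.

Lemma Po_mulrn_l x : x \in PoL -> exists2 c, c \in PoE & x *+ l = jE c.
Proof.
apply: (PoPred_ind (H := [set x | exists2 c, c \in PoE & x *+ l = jE c])) => [|q q_ge2] /=.
  split; first by apply/mem_set; exists 0; rewrite ?rpred0 // mul0rn raddf0.
  move=> y z /set_mem /= [c Pc yE] /set_mem /= [d Pd zE]; apply/mem_set => /=.
  by exists (c - d); rewrite ?rpredB // mulrnBl yE zE raddfB.
have [->|[p p_pr ->]] := polya_cases galL q; last exact: primeRad_mulrn_l.
by exists 0; rewrite ?rpred0 // cls0 mul0rn raddf0.
Qed.

Lemma Po_mulrn_2 x : x \in PoL ->
  exists2 c, c \in PoK & c *+ l = 0 /\ x *+ 2 = jK c.
Proof.
apply: (PoPred_ind (H := [set x | exists2 c, c \in PoK & c *+ l = 0 /\ x *+ 2 = jK c]))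
  => [|q q_ge2] /=.
  split; first by apply/mem_set; exists 0; rewrite ?rpred0 // !mul0rn raddf0.
  move=> y z /set_mem /= [c Pc [cl yE]] /set_mem /= [d Pd [dl zE]]; apply/mem_set => /=.
  by exists (c - d); rewrite ?rpredB // !mulrnBl yE zE cl dl subrr raddfB.
have [->|[p p_pr ->]] := polya_cases galL q; last exact: primeRad_mulrn_2.
by exists 0; rewrite ?rpred0 // cls0 !mul0rn raddf0.
Qed.

Lemma dvdn_classNumber c : ~~ (l %| classNumber K)%N -> c *+ l = 0 -> c = 0 :> Cl K.
Proof.
move=> lh cl; apply/eqP; apply: contraNT lh => c0; rewrite /classNumber.
have [fK|nfK] := pselect (finite_set [set: Cl K]).
  by apply/(zmod_cauchy l_prime fK); exists c.
(* For an infinite class group [classNumber] is 0, which [l] divides. *)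
by rewrite /fset_set; case: pselect => // ?; rewrite cardfs0.
Qed.

End Dihedral.

Lemma val_PoMn (L : fieldExtType rat) (M : {subfield L}) (x : Po M) n :
  val (x *+ n) = val x *+ n.
Proof. exact: raddfMn. Qed.

Lemma val_PoB (L : fieldExtType rat) (M : {subfield L}) (x y : Po M) :
  val (x - y) = val x - val y.
Proof. by []. Qed.

Lemma val_Po0 (L : fieldExtType rat) (M : {subfield L}) : val (0 : Po M) = 0.
Proof. by []. Qed.

Theorem theorem3p2 (l : nat) (L : splittingFieldType rat) (K E : {subfield L})
    (l_prime : prime l) (l_odd : odd l)
    (K_deg : \dim K = l) (K_nonGalois : ~~ galois 1 K)
    (L_closure : galoisClosure K {:L})
    (L_dihedral : 'Gal({:L} / 1) \isog 'D_(l.*2))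
    (E_quadratic : \dim E = 2%N) :
  [/\ exists (f : {additive Po E -> Po {:L}}) (g : {additive Po {:L} -> Po K}),
        injective f /\ (forall x, g x = 0 <-> exists y, f y = x),
      isomorphic (torsion 2 (Po {:L})) (Po E),
      embeds (torsion l (Po {:L})) (Po K)
    & ~~ (l %| classNumber K)%N -> isomorphic (Po E) (Po {:L})].
Proof.
have [_ galL _] := L_closure.
have L_deg : #|'Gal({:L} / 1)%g| = l.*2.
  by rewrite (card_isog L_dihedral) card_dihedral // prime_gt1.
pose jE : {additive Cl E -> Cl {:L}} := clext (subvf E).
pose jK : {additive Cl K -> Cl {:L}} := clext (subvf K).
have jEP c : c \in @PoPred L E -> jE c = 0 -> c = 0.
  exact: (jE_inj l_prime l_odd galL L_deg E_quadratic).
have jKP c : c *+ l = 0 -> jK c = 0 -> c = 0.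
  exact: (jK_inj l_prime l_odd K_deg galL L_deg).
have [||y fy|f fE] := @additive_choice (Po E) (Po {:L}) (fun y x => val x = jE (val y)).
- move=> y; have Py : jE (val y) \in @PoPred L {:L}%AS.
    exact: (jE_Po l_prime galL L_deg E_quadratic (valP y)).
  by exists (Sub (jE (val y)) Py); rewrite SubK.
- by move=> x x' y y' xE xE'; rewrite !val_PoB xE xE' raddfB.
- by apply: val_inj; rewrite fy val_Po0 raddf0.
(* The clause [c *+ l = 0] is what makes [c] unique, since [jK] is injective on [l]-torsion. *)
have [||c [cK cl]|g gP] := @additive_choice (Po {:L}) (Po K)
    (fun x c => jK (val c) = val x *+ 2 /\ c *+ l = 0).
- move=> x; have [c Pc [cl cx]] := Po_mulrn_2 l_prime K_deg galL L_deg (valP x).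
  exists (Sub c Pc); split; first by rewrite SubK.
  by apply: val_inj; rewrite val_PoMn SubK.
- move=> x x' c c' [cE cl] [cE' cl']; split; last by rewrite mulrnBl cl cl' subrr.
  by rewrite !val_PoB raddfB cE cE' mulrnBl.
- apply: val_inj; apply: jKP; first by rewrite -val_PoMn cl.
  by rewrite cK val_Po0 mul0rn.
have f_inj : injective f.
  move=> y y' fyy; apply/eqP; rewrite -subr_eq0; apply/eqP/val_inj.
  by apply: (jEP _ (valP (y - y'))); rewrite -fE raddfB fyy subrr.
(* For odd [l], an element killed by 2 equals its multiple by [l], and that multiple comes from
   Po(E). *)
have f_img x : x *+ 2 = 0 <-> exists y, f y = x.
  split=> [x2|[y <-]]; last first.
    apply: val_inj; rewrite val_PoMn fE -raddfMn.
    rewrite (Po_quadratic_torsion l_prime galL L_deg E_quadratic (valP y)).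
    exact: raddf0.
  have [c Pc xl] := Po_mulrn_l l_prime galL L_deg E_quadratic (valP x).
  exists (Sub c Pc); apply: val_inj; rewrite fE SubK; apply: etrans (esym xl) _.
  rewrite -val_PoMn -(odd_double_half l) l_odd -mul2n mulrnDr mulrnA x2 mul0rn.
  by rewrite addr0 mulr1n.
have g_ker x : g x = 0 <-> x *+ 2 = 0.
  have [gx gl] := gP x; split=> [gx0|x2].
    by apply: val_inj; rewrite val_PoMn -gx gx0 val_Po0 raddf0.
  apply: val_inj; apply: jKP; first by rewrite -val_PoMn gl.
  by rewrite gx -val_PoMn x2.
have g_tors x : g x *+ l = 0 by case: (gP x).
split.
- by exists f, g; split=> // x; rewrite g_ker.
- exact: torsion2_isomorphic f_inj f_img.
- exact: (odd_torsion_embeds l_odd g_ker).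
- move=> lh; apply: (torsion_free_isomorphic f_inj f_img g_ker g_tors) => c cl.
  by apply/val_inj/(dvdn_classNumber l_prime lh); rewrite -val_PoMn cl.
Qed.
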